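(* Suppose the self-similar measure $\mu$ satisfies the standard technical assumptions, and let $\Omega'\subseteq\Omega$ be a loop class of positive type. Then the set $\{\dim\mu(x): x \text{ a positive periodic point in } \Omega'\}$ is dense in the set of all local dimensions $\{\dim\mu(x): x \text{ in } \Omega',\ \dim\mu(x)\text{ exists}\}$. It is also dense in the set of all upper local dimensions $\{\overline{\dim}\,\mu(x): x\text{ in }\Omega'\}$, and in the set of all lower local dimensions $\{\underline{\dim}\,\mu(x): x\text{ in }\Omega'\}$.
   Context: Measure. Let $m\ge 1$, $0<\varrho<1$, $d_0<\dots<d_m$ real, $S_j(x)=\varrho x+d_j$, $\mathcal A=\{0,\dots,m\}$. For $\sigma=(j_1,\dots,j_n)\in\mathcal A^n$ put $S_\sigma=S_{j_1}\circ\cdots\circ S_{j_n}$. Given $p_j>0$ with $\sum_j p_j=1$, $\mu$ is the unique Borel probability measure with $\mu=\sum_{j=0}^m p_j\,\mu\circ S_j^{-1}$. It is of finite type if there is a finite set $F\subset[0,\infty)$ such that for all $n\ge1$ and $\sigma,\sigma'\in\mathcal A^n$ either $\varrho^{-n}|S_\sigma(0)-S_{\sigma'}(0)|>c$ or $\varrho^{-n}|S_\sigma(0)-S_{\sigma'}(0)|\in F$, where $c=(1-\varrho)^{-1}(d_m-d_0)$. Standard technical assumptions: $\mu$ is such a measure and is of finite type; $p_0=p_m=\min_j p_j$; and $\operatorname{supp}\mu=[0,1]$ (equivalently $d_0=0$, $d_m=1-\varrho$, $d_{i+1}-d_i\le\varrho$ for all $i$). Local dimensions. $\overline{\dim}\,\mu(x)=\limsup_{r\to0^+}\frac{\log\mu([x-r,x+r])}{\log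 r}$, $\underline{\dim}\,\mu(x)$ is the corresponding $\liminf$, and $\dim\mu(x)$ is the limit when it exists. Net intervals and characteristic vectors. For $n\ge1$ let $h_1<\dots<h_{s_n}$ be the distinct elements of $\{S_\sigma(0),S_\sigma(1):\sigma\in\mathcal A^n\}$; the net intervals of level $n$ are $\mathcal F_n=\{[h_j,h_{j+1}]:1\le j<s_n\}$, and $\mathcal F_0=\{[0,1]\}$. Each $\Delta\in\mathcal F_n$ ($n\ge1$) lies in a unique $\widehat\Delta\in\mathcal F_{n-1}$, its parent ($\Delta$ is a child of $\widehat\Delta$). For $\Delta=[a,b]\in\mathcal F_n$ put $\ell_n(\Delta)=\varrho^{-n}(b-a)$, and let $V_n(\Delta)=(a_1,\dots,a_k)$ be the increasing list of the distinct values $\varrho^{-n}(a-S_\sigma(0))$ over $\sigma\in\mathcal A^n$ with $\Delta\subseteq S_\sigma[0,1]$. Let $r_n(\Delta)$ be the position of $\Delta$, from left to right, among the children of $\widehat\Delta$ with the same $\ell_n$ and $V_n$. The characteristic vector is $\mathcal C_n(\Delta)=(\ell_n(\Delta),V_n(\Delta),r_n(\Delta))$, with $\mathcal C_0([0,1])=(1,(0),1)$. $\Omega$ is the (finite) set of all characteristic vectors. $\beta\in\Omega$ is a child of $\alpha\in\Omega$ (its parent) if $\alpha=\mathcal C_{n-1}(\widehat\Delta)$, $\beta=\mathcal C_n(\Delta)$ for some parent/child pair. An admissible path is a tuple $(\gamma_1,\dots,\gamma_n)$ in $\Omega$ with each $\gamma_j$ the parent of $\gamma_{j+1}$; its length is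 $L=n$. A symbolic representation of $x\in[0,1]$ is $[x]=(\mathcal C_0(\Delta_0),\mathcal C_1(\Delta_1),\dots)$, where $x\in\Delta_n\in\mathcal F_n$ and $\Delta_n$ is the parent of $\Delta_{n+1}$ for all $n$ (unique unless $x$ is an endpoint of a net interval, in which case there may be two). Transition matrices. For $\Delta=[a,b]\in\mathcal F_n$ with parent $\widehat\Delta=[c,d]$, $V_n(\Delta)=(a_1,\dots,a_K)$, $V_{n-1}(\widehat\Delta)=(c_1,\dots,c_J)$, the primitive transition matrix $T(\mathcal C_{n-1}(\widehat\Delta),\mathcal C_n(\Delta))$ is the $J\times K$ matrix with $(j,k)$ entry $p_0^{-1}p_\ell$ if $\ell\in\mathcal A$ satisfies $c-\varrho^{n-1}c_j+\varrho^{n-1}d_\ell=a-\varrho^na_k$, and $0$ if there is no such $\ell$ (it depends only on the two characteristic vectors). For an admissible path, $T(\gamma_1,\dots,\gamma_n)=T(\gamma_1,\gamma_2)\cdots T(\gamma_{n-1},\gamma_n)$. A matrix is positive if all entries are strictly positive. Loop classes. A non-empty $\Omega'\subseteq\Omega$ is a loop class if for all $\alpha,\beta\in\Omega'$ there is an admissible path $(\gamma_1,\dots,\gamma_n)$, $n\ge2$, with all $\gamma_j\in\Omega'$, $\gamma_1=\alpha$, $\gamma_n=\beta$. It is of positive type if some admissible path $\eta$ in $\Omega'$ (all its members in $\Omega'$) has $T(\eta)$ positive. A point $x$ is in $\Omega'$ if it has a symbolic representation $(\gamma_0,\gamma_1,\dots)$ with $\gamma_j\in\Omega'$ for all large $j$.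 Periodic points. $x$ is periodic with period $\theta$ if it has a symbolic representation $(\gamma_0,\dots,\gamma_s,\theta^-,\theta^-,\dots)$, where $\theta$ is an admissible cycle (a path of length at least 2 with equal first and last letters) and $\theta^-$ is $\theta$ with its last letter deleted. A positive periodic point in $\Omega'$ is one having such a period $\theta$ lying in $\Omega'$ with $T(\theta)$ positive. *)

(* Defs.v *)
From HB Require Import structures.
From mathcomp Require Import all_boot all_order all_algebra.
From mathcomp Require Import all_classical all_reals all_analysis.

Set Implicit Arguments.
Unset Strict Implicit.
Unset Printing Implicit Defensive.

Import Order.TTheory GRing.Theory Num.Theory.
Import numFieldNormedType.Exports.

Local Open Scope classical_set_scope.
Local Open Scope ring_scope.

Definition strictly_positive (R : realType) (J K : nat) (M : 'M[R]_(J, K)) :=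
  forall j k, 0 < M j k.

(* [A] is dense in [B] as a subset of [B]. *)
Definition dense_in (T : topologicalType) (A B : set T) :=
  A `<=` B /\ B `<=` closure A.

Section LocalDimension.
Context {R : realType}.
Implicit Types (mu : probability (measurableTypeR R) R) (x : R).

Definition msupport mu : set R :=
  [set x | forall U : set R, open U -> U x -> (0 < mu U)%E].

(* Inside the support the measure of the interval is a positive real, so that
   neither [fine] nor [ln] hits a default value. *)
Definition dim_ratio mu x (r : R) : R :=
  ln (fine (mu [set` `[x - r, x + r]])) / ln r.

Definition upper_dim mu x : \bar R :=
  limf_esup (fun r => (dim_ratio mu x r)%:E) (0 : R)^'+.

Definition lower_dim mu x : \bar R :=
  limf_einf (fun r => (dim_ratio mu x r)%:E) (0 : R)^'+.

Definition has_dim mu x (y : \bar R) :=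
  (fun r => (dim_ratio mu x r)%:E) @ (0 : R)^'+ --> y.

End LocalDimension.

(* Characteristic vectors: (normalized length, neighbour list, index). *)
Definition charvec (R : realType) : Type := (R * seq R * nat)%type.

Section FiniteType.
Context {R : realType} {m : nat}.
Variables (rho : R) (d p : 'I_m.+1 -> R).

Local Notation word n := (n.-tuple 'I_m.+1).
Local Notation cv := (charvec R).

Implicit Types (mu : probability (measurableTypeR R) R) (D E : R * R)
  (a b : cv) (s : seq cv) (X : set cv) (x : R).

Definition sim (j : 'I_m.+1) (x : R) : R := rho * x + d j.

(* [S_word [:: j1; ...; jn] = sim j1 \o ... \o sim jn] *)
Definition S_word (w : seq 'I_m.+1) (x : R) : R := foldr sim x w.

Definition self_similar mu := forall A : set R,
  measurable (A : set (measurableTypeR R)) ->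
  (mu A = \sum_(j < m.+1) (p j)%:E * mu (sim j @^-1` A))%E.

Definition finite_type := exists F : set R,
  [/\ finite_set F, F `<=` [set t | 0 <= t] &
    forall (n : nat) (w w' : word n), (0 < n)%N ->
      let t := rho ^- n * `|S_word w 0 - S_word w' 0| in
      (1 - rho)^-1 * (d ord_max - d ord0) < t \/ F t].

Record standard_assumptions mu : Prop := StandardAssumptions {
  sa_m : (0 < m)%N;
  sa_rho : 0 < rho < 1;
  sa_d : {homo d : i j / (i < j)%N >-> i < j};
  sa_p_gt0 : forall j, 0 < p j;
  sa_p_sum : \sum_(j < m.+1) p j = 1;
  sa_self_similar : self_similar mu;
  sa_finite_type : finite_type;
  sa_p_ends : p ord0 = p ord_max;
  sa_p_min : forall j, p ord0 <= p j;
  sa_support : msupport mu = [set` `[0, 1]]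
}.

Definition endpoints n : seq R := sort <=%O (undup
  ([seq S_word w 0 | w : word n] ++ [seq S_word w 1 | w : word n])).

(* The net intervals [h_1, h_2], [h_2, h_3], ... of level n, from left to right,
   the interval [a, b] being represented by the pair (a, b).  Level 0 is the case
   of the empty word; [net0] and [char_vec0] give its conventional values. *)
Definition net n : seq (R * R) := zip (endpoints n) (behead (endpoints n)).

Definition sub_itv D E := (E.1 <= D.1) && (D.2 <= E.2).

Definition is_parent n E D := [&& E \in net n, D \in net n.+1 & sub_itv D E].

Definition parent n D : R * R := head (0, 1) [seq E <- net n | sub_itv D E].

Definition ell n D : R := rho ^- n * (D.2 - D.1).

(* As rho > 0, the interval S_w [0, 1] is [S_w 0, S_w 1]. *)
Definition nbhd n D : seq R := sort <=%O (undup
  [seq rho ^- n * (D.1 - S_word w 0)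
    | w : word n <- enum {: word n} & sub_itv D (S_word w 0, S_word w 1)]).

Definition twins n E D : seq (R * R) :=
  [seq D' <- net n.+1 | [&& sub_itv D' E, ell n.+1 D' == ell n.+1 D
                          & nbhd n.+1 D' == nbhd n.+1 D]].

(* Positions are counted from 1. *)
Definition rank n D : nat :=
  if n is n'.+1 then (index D (twins n' (parent n' D) D)).+1 else 1%N.

Definition char_vec n D : cv := (ell n D, nbhd n D, rank n D).

Lemma net0 : net 0 = [:: (0, 1)].
Proof.
rewrite /net /endpoints.
have E c : [seq S_word w c | w : word 0] = [:: c].
  rewrite /image_mem.
  have : size (enum {: word 0}) = 1%N by rewrite -cardE card_tuple expn0.
  by case: (enum _) => [|w []] //= _; rewrite tuple0.
by rewrite !E /= inE eq_sym oner_eq0 /= sort_le_id //= ler01.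
Qed.

Lemma char_vec0 : char_vec 0 (0, 1) = (1, [:: 0], 1%N).
Proof.
rewrite /char_vec /ell /nbhd /sub_itv /= expr0 invr1 !mul1r subr0.
have : size (enum {: word 0}) = 1%N by rewrite -cardE card_tuple expn0.
by case: (enum _) => [|w []] //= _; rewrite tuple0 /= !lexx /= subrr mulr0.
Qed.

Definition nb a : seq R := a.1.2.

Definition Omega : set cv :=
  [set a | exists n D, D \in net n /\ a = char_vec n D].

(* [w] is (n, E, D) with E the parent, at level n, of the net interval D *)
Definition realizes a b (w : nat * (R * R) * (R * R)) :=
  let: (n, E, D) := w in
  [/\ is_parent n E D, char_vec n E = a & char_vec n.+1 D = b].

Definition is_child : rel cv := fun a b => `[< exists w, realizes a b w >].

(* The primitive transition matrix depends only on the two characteristic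
   vectors, so it is computed from an arbitrary parent/child pair realizing
   them. *)
Definition trans_mx a b : 'M[R]_(size (nb a), size (nb b)) :=
  let: (n, E, D) := xget (0%N, (0, 1), (0, 1)) (realizes a b) in
  \matrix_(j, k)
    if [pick l | E.1 - rho ^+ n * (nb a)`_j + rho ^+ n * d l
                 == D.1 - rho ^+ n.+1 * (nb b)`_k] is Some l
    then (p ord0)^-1 * p l else 0.

(* The path (a, s_1, ..., s_k) is represented by its head [a] and its tail [s];
   a path of length 1 has the identity as (empty) product of matrices. *)
Fixpoint path_mx a s : 'M[R]_(size (nb a), size (nb (last a s))) :=
  if s is b :: s' then trans_mx a b *m path_mx b s' else 1%:M.

Definition admissible_in X a s :=
  path is_child a s /\ forall b, b \in a :: s -> X b.

Definition loop_class X := [/\ X !=set0, X `<=` Omega &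
  forall a b, X a -> X b ->
    exists s, [/\ s <> [::], admissible_in X a s & last a s = b]].

Definition positive_type X :=
  exists a s, admissible_in X a s /\ strictly_positive (path_mx a s).

Definition symbolic_rep x (g : nat -> cv) := exists D_ : nat -> R * R,
  forall n, [/\ D_ n \in net n, x \in `[(D_ n).1, (D_ n).2],
    is_parent n (D_ n) (D_ n.+1) & g n = char_vec n (D_ n)].

Definition point_in X x :=
  exists2 g, symbolic_rep x g & \forall j \near \oo, X (g j).

(* [g] is (g_0, ..., g_q) followed by infinitely many copies of the cycle (a, s)
   deprived of its last letter, i.e. of [belast a s], of length [size s]. *)
Definition has_period x a s := exists2 g, symbolic_rep x g &
  exists q, forall k, g (q.+1 + k)%N = nth a (belast a s) (k %% size s).

Definition positive_periodic X x := exists a s,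
  [/\ s <> [::], last a s = a, admissible_in X a s,
      strictly_positive (path_mx a s) & has_period x a s].

End FiniteType.

(* Main.v *)
(* The words w of length n with S_w [0, 1] containing the level n net interval
   Delta_n(x) have total weight Q_n = sum p_w, and log mu([x - r, x + r]) equals
   log Q_n up to o(n) when r is of the order of rho ^ n: the words that meet the
   ball without covering Delta_n(x) have an endpoint of S_w [0, 1] in common with
   it, and as p_0 = p_m = min p_j these weigh at most n / p_0 times Q_n.  Along a
   path, Q_n is, up to a constant, p_0 ^ n times the sum of the entries of the
   transition matrix.  Given x in the loop class, close the path
   gamma_J, ..., gamma_n of x into a cycle by one of finitely many paths whose
   matrix B is positive, with entries at least 1.  Writing P for the matrix of
   gamma_J, ..., gamma_n, the sum of the entries of (P B) ^ k lies between the k-th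
   powers of those of P and of C times it, C independent of n; so by Fekete's lemma
   the periodic point has a local dimension, at distance O(1 / n) from
   log Q_n / (n log rho). *)
Require Import Defs.
From mathcomp Require Import all_boot all_order all_algebra.
From mathcomp Require Import all_classical all_reals all_analysis.
From mathcomp Require Import measurable_realfun lra ring.

Set Implicit Arguments.
Unset Strict Implicit.
Unset Printing Implicit Defensive.

Import Order.TTheory GRing.Theory Num.Theory.
Import numFieldNormedType.Exports.

Local Open Scope classical_set_scope.
Local Open Scope ring_scope.

(** * Words and net intervals *)

(** Dividing the transition matrices by p_0, the least probability, makes every nonzero entry at
    least 1. Finite type enters twice. It keeps distinct endpoints of level n at least eps rho ^ n
    apart, so a small ball only sees words that cover Delta_n(x) or share an endpoint with it. It
    also makes the loop class finite, so the lengths and norms of the closing paths are bounded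
    independently of n. For a general x the ratio log mu([x - r, x + r]) / log r has no limit. What
    is approximated is any value that this ratio approaches along some r tending to 0. The limit,
    the upper limit and the lower limit all have this property, so one density argument serves the
    three sets. The support hypothesis speaks of the measure; the conditions d_0 = 0, d_m = 1 - rho
    and d_(i+1) - d_i <= rho on which the combinatorics rests are derived from it. *)

Lemma big_tuple_rcons (V : Type) (idx : V) (op : Monoid.com_law idx)
    (T : finType) n (P : pred (seq T)) (F : seq T -> V) :
  \big[op/idx]_(w : n.+1.-tuple T | P w) F w =
  \big[op/idx]_(w : n.-tuple T) \big[op/idx]_(l | P (rcons w l)) F (rcons w l).
Proof.
rewrite pair_big_dep /=.
pose h (x : n.-tuple T * T) := rcons_tuple x.1 x.2.
have hi : injective h.
  move=> [w l] [w' l'] /(congr1 val) /= /rcons_inj [/val_inj -> ->] //.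
rewrite (reindex h) //; apply/onW_bij/(inj_card_bij hi).
by rewrite card_prod !card_tuple expnSr.
Qed.

(** An index-free description of consecutive elements: later arguments treat a net interval as a gap
    between endpoints. *)
Lemma mem_zip_behead (R : realType) (s : seq R) (D : R * R) : sorted <%R s ->
  D \in zip s (behead s) <->
  [/\ D.1 \in s, D.2 \in s, D.1 < D.2 & forall c, c \in s -> c <= D.1 \/ D.2 <= c].
Proof.
case: s => [|x s]; first by split => // -[].
elim: s x => [|y s IH] x /=.
  by move=> _; split => // -[]; rewrite !in_cons !in_nil !orbF => /eqP -> /eqP ->; rewrite ltxx.
move=> /andP[xy sys].
have lt_y c : c \in y :: s -> y <= c.
  rewrite in_cons => /orP[/eqP ->//|]; move: sys.
  by rewrite (path_sortedE lt_trans) => /andP[/allP h _] /h /ltW.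
have {IH} := IH y sys; rewrite /= => IH.
rewrite in_cons; split.
- move=> /orP[/eqP -> /=|/IH[h1 h2 h3 h4]].
    split => //; rewrite ?in_cons ?eqxx ?orbT// => c.
    by rewrite in_cons => /orP[/eqP ->|/lt_y]; [left|right].
  split; rewrite ?(in_cons x) ?h1 ?h2 ?orbT// => c.
  rewrite in_cons => /orP[/eqP ->|/h4//].
  by left; apply: le_trans (lt_y _ h1); apply: ltW.
- case: D IH => a b /= IH [].
  rewrite in_cons => /orP[/eqP ->|ain].
    rewrite in_cons => /orP[/eqP ->|bin]; first by rewrite ltxx.
    move=> xb /(_ y); rewrite !in_cons eqxx orbT => /(_ isT)[|].
      by rewrite leNgt xy.
    by move=> bley; rewrite xpair_eqE eqxx /= eq_le bley lt_y.
  rewrite in_cons => /orP[/eqP ->|bin] ab h4.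
    by move: (le_lt_trans (lt_y _ ain) ab) => /lt_trans /(_ xy); rewrite ltxx.
  apply/orP; right; apply/IH; split => // c cin; apply: h4.
  by rewrite in_cons cin orbT.
Qed.

Lemma sorted_zip_behead (R : realType) (s : seq R) : sorted <%R s ->
  sorted (fun D E : R * R => D.1 < E.1) (zip s (behead s)).
Proof.
case: s => // x s; elim: s x => // y [|z s] IH x //= /andP[xy h].
by rewrite xy; exact: IH.
Qed.

Lemma ord_homo_le (R : realType) (m : nat) (f : 'I_m.+1 -> R) :
  {homo f : i j / (i < j)%N >-> i < j} ->
  forall i j : 'I_m.+1, (i <= j)%N -> f i <= f j.
Proof.
move=> f_lt i j; rewrite leq_eqVlt => /orP[/eqP/val_inj -> //|ij].
by rewrite ltW// f_lt.
Qed.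

Section UnitIFS.
Context {R : realType} {m : nat}.
Variables (rho : R) (d p : 'I_m.+1 -> R).

(* The hull of the support is normalized to be [0, 1]. *)
Record unit_ifs : Prop := UnitIFS {
  ui_rho : 0 < rho < 1;
  ui_d : {homo d : i j / (i < j)%N >-> i < j};
  ui_d0 : d ord0 = 0;
  ui_dm : d ord_max = 1 - rho;
  ui_gap : forall i j : 'I_m.+1, j = i.+1 :> nat -> d j <= rho + d i;
  ui_p0 : forall j, 0 < p j;
  ui_p1 : \sum_j p j = 1;
  ui_pmin : forall j, p ord0 <= p j;
  ui_pmax : p ord0 = p ord_max;
  ui_ft : finite_type rho d
}.

Hypothesis H : unit_ifs.

Local Notation word n := (n.-tuple 'I_m.+1).
Local Notation S := (S_word rho d).
Local Notation net := (net rho d).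
Local Notation endpoints := (endpoints rho d).

Let rho0 : 0 < rho. Proof. by have /andP[] := ui_rho H. Qed.
Let rho1 : rho < 1. Proof. by have /andP[] := ui_rho H. Qed.
Let rn0 n : 0 < rho ^+ n. Proof. exact: exprn_gt0. Qed.

Lemma S_wordE w x : S w x = rho ^+ size w * x + S w 0.
Proof.
elim: w => [|j w IH] /=; first by rewrite expr0 mul1r addr0.
by rewrite /sim IH exprS; ring.
Qed.

Lemma S_word1 w : S w 1 = S w 0 + rho ^+ size w.
Proof. by rewrite S_wordE mulr1 addrC. Qed.

Lemma S_rcons w l x : S (rcons w l) x = S w (sim rho d l x).
Proof. by rewrite /S_word foldr_rcons. Qed.

Lemma S_rcons0 w l : S (rcons w l) 0 = S w 0 + rho ^+ size w * d l.
Proof. by rewrite S_rcons S_wordE /sim mulr0 add0r addrC. Qed.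

Lemma S_rcons1 w l : S (rcons w l) 1 = S w 0 + rho ^+ size w * (rho + d l).
Proof. by rewrite S_rcons S_wordE /sim mulr1 addrC. Qed.

Lemma d_inj : injective d.
Proof.
move=> i j dij; case: (ltngtP i j) => [/(ui_d H)|/(ui_d H)|/val_inj//];
  by rewrite dij ltxx.
Qed.

Lemma d_ge0 l : 0 <= d l.
Proof. by rewrite -(ui_d0 H); apply: (ord_homo_le (ui_d H)). Qed.

Lemma d_le1 l : rho + d l <= 1.
Proof. by have := @ord_homo_le _ _ _ (ui_d H) l ord_max; rewrite -ltnS ltn_ord (ui_dm H) => /(_ isT); lra. Qed.

Lemma S_ge0 w : 0 <= S w 0.
Proof.
elim: w => [|j w IH] //=.
by apply: addr_ge0 (d_ge0 j); apply: mulr_ge0 IH; apply: ltW.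
Qed.

Lemma S_le1 w : S w 1 <= 1.
Proof.
elim: w => [|j w IH] //=; rewrite /sim; have := d_le1 j.
have : rho * S w 1 <= rho by rewrite ger_pMr.
by rewrite /S_word; lra.
Qed.

Lemma endpointsP n x :
  x \in endpoints n <-> exists w : word n, x = S w 0 \/ x = S w 1.
Proof.
rewrite /endpoints mem_sort mem_undup mem_cat; split.
  by case/orP => /mapP[w _ ->]; exists w; [left|right].
by case=> w [->|->]; apply/orP; [left|right]; apply/mapP; exists w => //; rewrite mem_enum.
Qed.

Lemma endpoints_S0 n (w : word n) : S w 0 \in endpoints n.
Proof. by apply/endpointsP; exists w; left. Qed.

Lemma endpoints_S1 n (w : word n) : S w 1 \in endpoints n.
Proof. by apply/endpointsP; exists w; right. Qed.

Lemma endpoints01 n x : x \in endpoints n -> 0 <= x <= 1.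
Proof.
case/endpointsP => w [->|->].
  rewrite S_ge0 /=; apply: le_trans (S_le1 w); rewrite S_word1 lerDl ltW//.
by rewrite S_le1 andbT S_word1 addr_ge0 ?S_ge0// ltW.
Qed.

Lemma endpointsS n x : x \in endpoints n -> x \in endpoints n.+1.
Proof.
case/endpointsP => w [->|->]; apply/endpointsP.
  exists (rcons_tuple w ord0); left.
  by rewrite S_rcons0 (ui_d0 H) mulr0 addr0.
exists (rcons_tuple w ord_max); right.
by rewrite S_rcons1 (ui_dm H) S_word1 subrKC mulr1.
Qed.

Lemma sorted_endpoints n : sorted <%R (endpoints n).
Proof. by rewrite sort_lt_sorted undup_uniq. Qed.

Lemma netP n D : D \in net n <-> [/\ D.1 \in endpoints n, D.2 \in endpoints n,
  D.1 < D.2 & forall c, c \in endpoints n -> c <= D.1 \/ D.2 <= c].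
Proof. exact/mem_zip_behead/sorted_endpoints. Qed.

Lemma sorted_net n : sorted (fun D E : R * R => D.1 < E.1) (net n).
Proof. exact/sorted_zip_behead/sorted_endpoints. Qed.

Lemma net_lt n D : D \in net n -> D.1 < D.2.
Proof. by case/netP. Qed.

(** No endpoint of level n lies inside D, so covering D is decided at a single point. The extension
    lemmas and [boundary_weight] need covering in this one-point form. *)
Lemma cover_net_left n D (w : word n) : D \in net n ->
  sub_itv D (S w 0, S w 1) = (S w 0 <= D.1 < S w 1).
Proof.
case/netP => _ _ lt12 gap; rewrite /sub_itv /=; congr (_ && _).
apply/idP/idP => [|h]; first exact: lt_le_trans.
by case: (gap _ (endpoints_S1 w)) => //; rewrite leNgt h.
Qed.

Lemma cover_net_right n D (w : word n) : D \in net n ->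
  sub_itv D (S w 0, S w 1) = (S w 0 < D.2 <= S w 1).
Proof.
case/netP => _ _ lt12 gap; rewrite /sub_itv /=; congr (_ && _).
apply/idP/idP => [h|h]; first exact: le_lt_trans lt12.
by case: (gap _ (endpoints_S0 w)) => //; rewrite leNgt h.
Qed.

(** The largest letter with d_l < t works: the next one has t <= d_(l+1), which is at most rho + d_l
    by the gap condition, and rho + d_m = 1 for the last letter. *)
Lemma exists_letter_left t : 0 < t -> t <= 1 -> exists l, d l < t <= rho + d l.
Proof.
move=> t0 t1; have h0 : d ord0 < t by rewrite (ui_d0 H).
case: (@arg_maxnP _ ord0 (fun l => d l < t) (@nat_of_ord _) h0) => l lt hl.
exists l; rewrite lt /=; have [lm|lm] := ltnP l m; last first.
  have -> : l = ord_max by apply/val_inj/eqP; rewrite eqn_leq lm -ltnS ltn_ord.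
  by rewrite (ui_dm H) subrKC.
pose l' := Ordinal (lm : l.+1 < m.+1)%N.
apply: le_trans (@ui_gap H l l' erefl); rewrite leNgt; apply/negP => /hl /=.
by rewrite ltnn.
Qed.

Lemma exists_letter_right t : 0 <= t -> t < 1 -> exists l, d l <= t < rho + d l.
Proof.
move=> t0 t1; have h0 : d ord0 <= t by rewrite (ui_d0 H).
case: (@arg_maxnP _ ord0 (fun l => d l <= t) (@nat_of_ord _) h0) => l lt hl.
exists l; rewrite lt /=; have [lm|lm] := ltnP l m; last first.
  have -> : l = ord_max by apply/val_inj/eqP; rewrite eqn_leq lm -ltnS ltn_ord.
  by rewrite (ui_dm H) subrKC.
pose l' := Ordinal (lm : l.+1 < m.+1)%N.
apply: lt_le_trans (@ui_gap H l l' erefl); rewrite ltNge; apply/negP => /hl /=.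
by rewrite ltnn.
Qed.

Let normK w h : h = S w 0 + rho ^+ size w * ((h - S w 0) / rho ^+ size w).
Proof. by rewrite mulrC divfK ?subrKC// gt_eqF. Qed.

Lemma extend_left w h : S w 0 < h <= S w 1 ->
  exists l, S (rcons w l) 0 < h <= S (rcons w l) 1.
Proof.
rewrite S_word1 => /andP[h0 h1].
have [||l /andP[l0 l1]] := @exists_letter_left ((h - S w 0) / rho ^+ size w).
- by rewrite divr_gt0// subr_gt0.
- by rewrite ler_pdivrMr// mul1r lerBlDl.
exists l; rewrite S_rcons0 S_rcons1 (normK w h).
by rewrite ltrD2l lerD2l ltr_pM2l// ler_pM2l// l0.
Qed.

Lemma extend_right w h : S w 0 <= h < S w 1 ->
  exists l, S (rcons w l) 0 <= h < S (rcons w l) 1.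
Proof.
rewrite S_word1 => /andP[h0 h1].
have [||l /andP[l0 l1]] := @exists_letter_right ((h - S w 0) / rho ^+ size w).
- by rewrite divr_ge0 ?subr_ge0// ltW.
- by rewrite ltr_pdivrMr// mul1r ltrBlDl.
exists l; rewrite S_rcons0 S_rcons1 (normK w h).
by rewrite ltrD2l lerD2l ltr_pM2l// ler_pM2l// l0.
Qed.

Lemma exists_cover_right n h : 0 <= h < 1 -> exists w : word n, S w 0 <= h < S w 1.
Proof.
move=> h01; elim: n => [|n [w /extend_right[l hl]]]; first by exists [tuple].
by exists (rcons_tuple w l).
Qed.

Lemma net_parent_uniq n E E' D : E \in net n -> E' \in net n -> D.1 < D.2 ->
  sub_itv D E -> sub_itv D E' -> E = E'.
Proof.
case: E E' => [a b] [a' b'].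
move=> /netP[/= ha hb lt1 gap] /netP[/= ha' hb' lt1' gap'] ltD.
move=> /andP[/= h1 h2] /andP[/= h3 h4].
have lts x y : x <= D.1 -> D.2 <= y -> x < y by move=> xx yy; lra.
congr pair; apply/eqP; rewrite eq_le; apply/andP; split.
- by case: (gap' _ ha) => // h; have := lts _ _ h1 h4; rewrite ltNge h.
- by case: (gap _ ha') => // h; have := lts _ _ h3 h2; rewrite ltNge h.
- by case: (gap _ hb') => // h; have := lts _ _ h1 h4; rewrite ltNge h.
- by case: (gap' _ hb) => // h; have := lts _ _ h3 h2; rewrite ltNge h.
Qed.

Lemma parentE n E D : is_parent rho d n E D -> parent rho d n D = E.
Proof.
move=> /and3P[En Dn DE]; rewrite /parent.
have : E \in [seq E <- net n | sub_itv D E] by rewrite mem_filter DE.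
case Es : [seq E <- net n | sub_itv D E] => [//|E' s] _ /=.
have : E' \in [seq E <- net n | sub_itv D E] by rewrite Es inE eqxx.
rewrite mem_filter => /andP[DE' E'n].
exact: (net_parent_uniq E'n En (net_lt Dn) DE' DE).
Qed.

Lemma cover_parent n E D (w : word n) l : is_parent rho d n E D ->
  sub_itv D (S (rcons w l) 0, S (rcons w l) 1) -> sub_itv E (S w 0, S w 1).
Proof.
move=> /and3P[En Dn /andP[DE1 DE2]] /andP[/=].
rewrite S_rcons0 S_rcons1 => h1 h2; have ltD := net_lt Dn.
rewrite cover_net_left//; have /netP[_ _ ltE gap] := En.
have Sw0 : S w 0 <= D.1.
  by apply: le_trans h1; rewrite lerDl mulr_ge0 ?d_ge0 ?ltW.
have Sw1 : D.2 <= S w 1.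
  apply: le_trans h2 _; rewrite S_word1 lerD2l.
  by rewrite ger_pMr// d_le1.
apply/andP; split.
  by case: (gap _ (endpoints_S0 w)) => // h; lra.
by lra.
Qed.

Lemma cover_child n E D (w : word n) : is_parent rho d n E D ->
  sub_itv E (S w 0, S w 1) ->
  exists l, sub_itv D (S (rcons w l) 0, S (rcons w l) 1).
Proof.
move=> /and3P[En Dn /andP[DE1 DE2]] /andP[/= h1 h2].
have ltD := net_lt Dn.
have [|l hl] := @extend_right w D.1; first by apply/andP; split; lra.
by exists l; rewrite (cover_net_left (rcons_tuple w l)).
Qed.

(* Finite type only controls distances of at most rho ^ n, hence the positions of
   the level n endpoints relative to a level n interval S_w [0, 1] around them. *)
Lemma endpoint_offsets : exists G : set R, [/\ finite_set G, G 0, G 1 &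
  forall n (w : word n) e, e \in endpoints n -> S w 0 <= e <= S w 1 ->
  G (rho ^- n * (e - S w 0))].
Proof.
have [F [finF F0 hF]] := ui_ft H.
have cE : (1 - rho)^-1 * (d ord_max - d ord0) = 1.
  rewrite (ui_d0 H) (ui_dm H) subr0 mulVf// subr_eq0 gt_eqF//.
(* Finite type speaks of n >= 1 only, so 0 is added for level 0. Both signs are needed because it
   controls absolute values, and the shift by 1 accounts for right endpoints. *)
pose F' := F `|` [set 0].
pose F2 := F' `|` [set - x | x in F'].
exists (F2 `|` [set 1 + x | x in F2]); split.
- rewrite /F2 /F' !finite_setU; do !split => //; try exact: finite_set1;
  do ?apply: finite_image; rewrite !finite_setU; do !split => //;
  try exact: finite_set1; do ?apply: finite_image; rewrite !finite_setU; do !split => //;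
  try exact: finite_set1.
- by left; left; right.
- by right; exists 0; rewrite ?addr0//; left; right.
move=> n w e.
have near (w' : word n) : rho ^- n * `|S w 0 - S w' 0| <= 1 ->
    F2 (rho ^- n * (S w' 0 - S w 0)).
  move=> h1; have : F' (rho ^- n * `|S w 0 - S w' 0|).
    case: n w e w' h1 => [|n] w e w' h1.
      by right; rewrite (tuple0 w) (tuple0 w') subrr normr0 mulr0.
    by have /= := hF n.+1 w w' erefl; rewrite cE => -[|h]; [rewrite ltNge h1|left].
  have [h|h] := leP (S w' 0) (S w 0).
    rewrite ger0_norm ?subr_ge0// => h'; right; eexists; first exact: h'.
    by rewrite -mulrN opprB.
  by rewrite distrC ger0_norm ?subr_ge0 ?ltW// => h'; left.
have scale x : `|x| <= rho ^+ n -> rho ^- n * `|x| <= 1.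
  by move=> h; rewrite mulrC ler_pdivrMr// mul1r.
case/endpointsP => w' [->|->] /andP[].
  rewrite S_word1 size_tuple => h1 h2; left; apply: near; apply: scale.
  by rewrite distrC ger0_norm ?subr_ge0// lerBlDl.
rewrite !S_word1 !size_tuple => h1 h2; right.
exists (rho ^- n * (S w' 0 - S w 0)); last first.
  by rewrite [X in _ = _ * X]addrAC [RHS]mulrDr mulVf ?gt_eqF// [LHS]addrC.
apply: near; apply: scale.
by rewrite ger0_norm; lra.
Qed.

(** eps is the least positive difference of two of the finitely many offsets, capped at 1. If e'
    lies beyond the interval S_w [0, 1] around e, then S_w 1 is an endpoint between e and e', so it
    is enough to compare endpoints within one such interval. *)
Lemma endpoint_spacing : exists2 eps : R, 0 < eps & forall n e e',
  e \in endpoints n -> e' \in endpoints n -> e < e' -> e + eps * rho ^+ n <= e'.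
Proof.
have [G [/finite_seqP[s ->] _ G1 hG]] := endpoint_offsets.
pose dif := [seq x - y | x <- s, y <- s].
pose eps : R := \big[Order.min/1]_(x <- dif | 0 < x) x.
have eps0 : 0 < eps.
  by rewrite /eps; elim/big_ind: _ => // x y x0 y0; rewrite lt_min x0.
have epsP x y : x \in s -> y \in s -> x < y -> eps <= y - x.
  move=> xs ys xy; rewrite /eps.
  have z0 : 0 < y - x by rewrite subr_gt0.
  have : y - x \in dif by apply/allpairsP; exists (y, x).
  elim: (dif) => //= z r IH; rewrite big_cons in_cons => /orP[/eqP <-|zr].
    by rewrite z0 ge_min lexx.
  by case: ifP => _; rewrite ?ge_min IH ?orbT.
exists eps => // n e e' en e'n ee'.
have /andP[e0 _] := endpoints01 en; have /andP[_ e1] := endpoints01 e'n.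
have [w /andP[w0 w1]] := @exists_cover_right n e ltac:(apply/andP; split; lra).
have key x y : x \in endpoints n -> y \in endpoints n -> S w 0 <= x -> y <= S w 1 ->
    x < y -> x + eps * rho ^+ n <= y.
  move=> xn yn x0 y1 xy.
  have Gx : rho ^- n * (x - S w 0) \in s.
    by apply: hG => //; rewrite x0 /=; lra.
  have Gy : rho ^- n * (y - S w 0) \in s.
    by apply: hG => //; apply/andP; split; lra.
  have := epsP _ _ Gx Gy; rewrite ltr_pM2l ?invr_gt0// ltrD2r xy => /(_ isT).
  rewrite -mulrBr opprB addrA subrK -(ler_pM2r (rn0 n)) mulrAC mulVf ?gt_eqF// mul1r.
  by lra.
case: (lerP e' (S w 1)) => e'w; first exact: key.
by apply: le_trans (ltW e'w); apply: key; rewrite ?endpoints_S1.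
Qed.

End UnitIFS.

(** * Transport of children between net intervals *)

Lemma tuple_rconsP (T : Type) n (w : n.+1.-tuple T) :
  exists (w' : n.-tuple T) (l : T), w = rcons_tuple w' l.
Proof.
case: w => s ss; case/lastP: s ss => [//|s l] ss.
have ss' : size s == n by rewrite size_rcons in ss.
by exists (Tuple ss'), l; apply/val_inj.
Qed.

Section Transport.
Context {R : realType} {m : nat}.
Variables (rho : R) (d p : 'I_m.+1 -> R).
Hypothesis H : unit_ifs rho d p.

Local Notation word n := (n.-tuple 'I_m.+1).
Local Notation S := (S_word rho d).
Local Notation net := (net rho d).
Local Notation endpoints := (endpoints rho d).
Local Notation nbhd := (nbhd rho d).
Local Notation ell := (ell rho).
Local Notation is_parent := (is_parent rho d).
Local Notation char_vec := (char_vec rho d).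
Local Notation realizes := (realizes rho d).

Implicit Types (D E : R * R) (a b : charvec R).

Let rho0 : 0 < rho. Proof. by have /andP[] := ui_rho H. Qed.
Let rn0 n : 0 < rho ^+ n. Proof. exact: exprn_gt0. Qed.
Let rnN n : rho ^+ n != 0. Proof. by rewrite gt_eqF. Qed.

Lemma mem_nbhd n E c : c \in nbhd n E <->
  exists2 w : word n, sub_itv E (S w 0, S w 1) & S w 0 = E.1 - rho ^+ n * c.
Proof.
rewrite /nbhd mem_sort mem_undup; split.
  case/mapP => w; rewrite mem_filter => /andP[h _] ->; exists w => //.
  by rewrite mulrA divff// mul1r subKr.
case=> w h e; apply/mapP; exists w; first by rewrite mem_filter h mem_enum.
by rewrite e subKr mulrA mulVf// mul1r.
Qed.

Lemma sorted_nbhd n E : sorted <%R (nbhd n E).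
Proof. by rewrite sort_lt_sorted undup_uniq. Qed.

(** The affine coordinate in which E becomes [0, [ell n E]]. In it, the children of E depend only on
    the length and the neighbour list of E. *)
Definition net_pt n E (t : R) : R := E.1 + rho ^+ n * t.
Definition net_coord n E (x : R) : R := rho ^- n * (x - E.1).

Lemma net_coordK n E x : net_pt n E (net_coord n E x) = x.
Proof. by rewrite /net_pt /net_coord mulrA divff// mul1r subrKC. Qed.

Lemma net_ptK n E t : net_coord n E (net_pt n E t) = t.
Proof. by rewrite /net_pt /net_coord addrAC subrr add0r mulrA mulVf// mul1r. Qed.

Lemma net_pt_ell n E : net_pt n E (ell n E) = E.2.
Proof. exact: net_coordK. Qed.

Lemma ler_net_pt n E s t : (net_pt n E s <= net_pt n E t) = (s <= t).
Proof. by rewrite lerD2l ler_pM2l. Qed.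

Lemma ltr_net_pt n E s t : (net_pt n E s < net_pt n E t) = (s < t).
Proof. by rewrite ltrD2l ltr_pM2l. Qed.

Lemma net_pt0 n E : net_pt n E 0 = E.1.
Proof. by rewrite /net_pt mulr0 addr0. Qed.

(** The right-hand side involves E only through [ell n E] and [nbhd n E]; this is why net intervals
    with equal length and neighbour list are subdivided in the same way. *)
Lemma net_endpoints n E t : E \in net n -> 0 <= t <= ell n E ->
  (net_pt n E t \in endpoints n.+1) =
  [|| t == 0, t == ell n E |
    has (fun c => [exists l, (t == d l - c) || (t == rho + d l - c)]) (nbhd n E)].
Proof.
move=> En /andP[t0 t1]; have /netP[E1n E2n _ gap] := En.
apply/idP/idP; last first.
  case/or3P => [/eqP ->|/eqP ->|/hasP[c /mem_nbhd[w cov ec] /existsP[l]]].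
  - by rewrite net_pt0 (endpointsS H).
  - by rewrite net_pt_ell (endpointsS H).
  move=> /orP[] /eqP -> {t t0 t1}; apply/endpointsP; exists (rcons_tuple w l);
    [left|right]; rewrite /= ?S_rcons0 ?S_rcons1 size_tuple ec /net_pt; ring.
have [//|tn0] := eqVneq t 0; have [//|tne /=] := eqVneq t (ell n E).
have tp : 0 < t by rewrite lt_neqAle eq_sym tn0.
have tl : t < ell n E by rewrite lt_neqAle tne.
have xE1 : E.1 < net_pt n E t by rewrite -{1}(net_pt0 n E) ltr_net_pt.
have xE2 : net_pt n E t < E.2 by rewrite -(net_pt_ell n E) ltr_net_pt.
case/endpointsP => w; have [w' [l ->]] := tuple_rconsP w.
rewrite /= S_rcons0 S_rcons1 size_tuple => xS.
(* S_w' [0, 1] contains a point strictly inside E, and its endpoints, being of level n, cannot lie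
   inside E. *)
have cov : sub_itv E (S w' 0, S w' 1).
  have xw : S w' 0 <= net_pt n E t <= S w' 1.
    rewrite S_word1 size_tuple; have := d_ge0 H l; have := d_le1 H l => d1 d0.
    have h1 : rho ^+ n * (rho + d l) <= rho ^+ n by rewrite ger_pMr.
    have h2 : rho ^+ n * d l <= rho ^+ n * (rho + d l) by rewrite ler_pM2l// lerDr ltW.
    have h3 : 0 <= rho ^+ n * d l by rewrite mulr_ge0// ltW.
    by case: xS => ->; apply/andP; split; lra.
  have /andP[x1 x2] := xw.
  apply/andP => /=; split.
    by case: (gap _ (endpoints_S0 _ _ w')) => //; lra.
  by case: (gap _ (endpoints_S1 _ _ w')) => //; lra.
pose c := rho ^- n * (E.1 - S w' 0).
have ec : S w' 0 = E.1 - rho ^+ n * c by rewrite mulrA divff// mul1r subKr.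
apply/hasP; exists c; first by apply/mem_nbhd; exists w'.
apply/existsP; exists l; apply/orP; clearbody c.
have inj u : net_pt n E t = S w' 0 + rho ^+ n * u -> t = u - c.
  move=> e; rewrite -(net_ptK n E t) e -[RHS](net_ptK n E) ec /net_pt.
  by congr (net_coord n E _); ring.
by case: xS => /inj ->; [left|right].
Qed.

(** The rank is left out: it tells siblings apart but does not influence the children. *)
Definition same_key n E n' E' :=
  [/\ E \in net n, E' \in net n', ell n E = ell n' E' & nbhd n E = nbhd n' E'].

Lemma same_keyC n E n' E' : same_key n E n' E' -> same_key n' E' n E.
Proof. by case. Qed.

Lemma char_vec_key n E n' E' : E \in net n -> E' \in net n' ->
  (char_vec n E).1 = (char_vec n' E').1 -> same_key n E n' E'.
Proof. by move=> h h' [? ?]; split. Qed.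

Definition transport n E n' E' D : R * R :=
  (net_pt n' E' (net_coord n E D.1), net_pt n' E' (net_coord n E D.2)).

Lemma transportK n E n' E' :
  cancel (transport n E n' E') (transport n' E' n E).
Proof. by case=> a b; rewrite /transport /= !net_ptK !net_coordK. Qed.

Lemma transport_parent n E n' E' D : same_key n E n' E' ->
  is_parent n E D -> is_parent n' E' (transport n E n' E' D).
Proof.
move=> [En E'n ellE nbE] /and3P[_ Dn /andP[DE1 DE2]].
have /netP[D1 D2 ltD gap] := Dn.
set s := net_coord n E D.1; set t := net_coord n E D.2.
have sE : D.1 = net_pt n E s by rewrite net_coordK.
have tE : D.2 = net_pt n E t by rewrite net_coordK.
have s0 : 0 <= s by rewrite -(ler_net_pt n E) net_pt0 -sE.
have tl : t <= ell n E by rewrite -(ler_net_pt n E) net_pt_ell -tE.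
have st : s < t by rewrite -(ltr_net_pt n E) -sE -tE.
have /netP[_ _ _ gapE'] := E'n.
have ends u : 0 <= u <= ell n E ->
    (net_pt n' E' u \in endpoints n'.+1) = (net_pt n E u \in endpoints n.+1).
  by move=> hu; rewrite !net_endpoints -?ellE// nbE.
apply/and3P; split => //; last first.
  rewrite /transport /sub_itv /= -/s -/t; apply/andP; split.
    by rewrite -{1}(net_pt0 n' E') ler_net_pt.
  by rewrite -(net_pt_ell n' E') ler_net_pt -ellE.
apply/netP; rewrite /transport /= -/s -/t; split.
- by rewrite ends -?sE// s0 (le_trans (ltW st)).
- by rewrite ends -?tE// tl (le_trans s0 (ltW st)).
- by rewrite ltr_net_pt.
move=> c cn; rewrite -(net_coordK n' E' c) !ler_net_pt.
set u := net_coord n' E' c.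
have [u0|u0] := ltP u 0; first by left; rewrite ltW// (lt_le_trans u0).
have [ul|ul] := ltP (ell n E) u; first by right; rewrite ltW// (le_lt_trans tl).
have : net_pt n E u \in endpoints n.+1.
  by rewrite -ends ?u0// /u net_coordK.
by move/gap; rewrite sE tE !ler_net_pt.
Qed.

Lemma transport_ell n E n' E' D :
  ell n'.+1 (transport n E n' E' D) = ell n.+1 D.
Proof.
rewrite /ell /transport /= /net_pt /net_coord !exprS; field.
by rewrite !rnN gt_eqF.
Qed.

(** Again only normalized data of E and D occur on the right, so neighbour lists are preserved by
    [transport]. The two inequalities on b say that the child word covers D. *)
Lemma mem_nbhd_child n E D (b : R) : is_parent n E D -> b \in nbhd n.+1 D <->
  exists2 c, c \in nbhd n E & exists l,
    [/\ rho * b = net_coord n E D.1 + c - d l, 0 <= b & b + ell n.+1 D <= 1].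
Proof.
move=> ED; have cov (w : word n) l c (b' : R) : S w 0 = E.1 - rho ^+ n * c ->
    rho * b' = net_coord n E D.1 + c - d l <->
    D.1 = S (rcons w l) 0 + rho ^+ n.+1 * b'.
  move=> ec; rewrite S_rcons0 size_tuple exprSr -mulrA ec; split => e.
    by rewrite e -{1}(net_coordK n E D.1) /net_pt; ring.
  by rewrite e /net_coord; field; apply: rnN.
have sub (w : word n) l (b' : R) : D.1 = S (rcons w l) 0 + rho ^+ n.+1 * b' ->
    sub_itv D (S (rcons w l) 0, S (rcons w l) 1) = (0 <= b') && (b' + ell n.+1 D <= 1).
  move=> e; rewrite /sub_itv /= {1}e lerDl pmulr_rge0//; congr (_ && _).
  rewrite S_word1 size_rcons size_tuple.
  rewrite -[in RHS](ler_pM2l (rn0 n.+1)) mulr1 mulrDr /ell mulrA divff// mul1r.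
  by rewrite -lerBlDl; congr (_ <= _); rewrite e; ring.
split.
  case/mem_nbhd => w; have [w' [l ew]] := tuple_rconsP w; rewrite {w}ew.
  rewrite /= => hw be.
  have e : D.1 = S (rcons w' l) 0 + rho ^+ n.+1 * b by rewrite be subrK.
  pose c := rho ^- n * (E.1 - S w' 0).
  have ec : S w' 0 = E.1 - rho ^+ n * c by rewrite mulrA divff// mul1r subKr.
  exists c.
    apply/mem_nbhd; exists w' => //; exact: (cover_parent H ED hw).
  by exists l; move: hw; rewrite (sub _ _ _ e) => /andP[]; split => //; apply/(cov w').
case=> c /mem_nbhd[w hw ec] [l [/(cov w l c b ec) e b0 b1]].
apply/mem_nbhd; exists (rcons_tuple w l); first by rewrite /= (sub _ _ _ e) b0.
by rewrite /= e addrK.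
Qed.

Lemma transport_nbhd n E n' E' D : same_key n E n' E' -> is_parent n E D ->
  nbhd n'.+1 (transport n E n' E' D) = nbhd n.+1 D.
Proof.
move=> key ED; have ED' := transport_parent key ED; have [_ _ _ nbE] := key.
apply: (irr_sorted_eq lt_trans (@ltxx _ _)); try exact: sorted_nbhd.
move=> b; apply/idP/idP; rewrite !(mem_nbhd_child _ ED) !(mem_nbhd_child _ ED');
  by rewrite transport_ell -nbE {1}/transport /= ?net_ptK.
Qed.

Lemma mem_twins n E D D' : E \in net n -> D' \in twins rho d n E D <->
  [/\ is_parent n E D', ell n.+1 D' = ell n.+1 D & nbhd n.+1 D' = nbhd n.+1 D].
Proof.
move=> En; rewrite mem_filter; split.
  by case/andP => /and3P[h /eqP ? /eqP ?] D'n; split => //; apply/and3P.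
by case=> /and3P[_ h1 h2] -> ->; rewrite h2 !eqxx.
Qed.

Lemma sorted_twins n E D : sorted (fun D E : R * R => D.1 < E.1) (twins rho d n E D).
Proof.
by apply: sorted_filter (sorted_net _ _ _) => x y z; apply: lt_trans.
Qed.

(** [transport] is increasing, hence keeps the left-to-right order of twins; this is what preserves
    the rank. *)
Lemma transport_twins n E n' E' D : same_key n E n' E' -> is_parent n E D ->
  twins rho d n' E' (transport n E n' E' D) =
  [seq transport n E n' E' D' | D' <- twins rho d n E D].
Proof.
move=> key ED; have [En E'n _ _] := key.
apply: (@irr_sorted_eq _ (fun D E : R * R => D.1 < E.1)).
- by move=> x y z; apply: lt_trans.
- by move=> x; apply: ltxx.
- exact: sorted_twins.
- apply: (@homo_sorted _ _ _ (fun D E : R * R => D.1 < E.1)) (sorted_twins _ _ _).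
  move=> x y xy; rewrite /transport /= ltr_net_pt.
  by rewrite -(ltr_net_pt n E) !net_coordK.
move=> D'; apply/idP/idP.
  case/(mem_twins _ _ E'n) => pD' e1 e2; apply/mapP.
  exists (transport n' E' n E D'); last by rewrite transportK.
  apply/(mem_twins _ _ En); split.
  - exact: transport_parent (same_keyC key) pD'.
  - by rewrite transport_ell e1 transport_ell.
  - by rewrite (transport_nbhd (same_keyC key))// e2 (transport_nbhd key).
case/mapP => D2 /(mem_twins _ _ En)[pD2 e1 e2] ->; apply/(mem_twins _ _ E'n).
by split; rewrite ?transport_ell ?e1 ?(transport_nbhd key)//; apply: transport_parent.
Qed.

Lemma transport_child n E n' E' D : same_key n E n' E' -> is_parent n E D ->
  is_parent n' E' (transport n E n' E' D) /\
  char_vec n'.+1 (transport n E n' E' D) = char_vec n.+1 D.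
Proof.
move=> key ED; have ED' := transport_parent key ED; split => //.
rewrite /char_vec transport_ell (transport_nbhd key ED) /rank.
rewrite (parentE ED) (parentE ED') (transport_twins key ED) index_map//.
exact: can_inj (@transportK _ _ _ _).
Qed.

(** This is the purpose of the rank: siblings of equal length and neighbour list are separated by
    their position. *)
Lemma child_uniq n E D D' : is_parent n E D -> is_parent n E D' ->
  char_vec n.+1 D = char_vec n.+1 D' -> D = D'.
Proof.
move=> ED ED'; rewrite /char_vec /rank (parentE ED) (parentE ED') => -[e1 e2].
have En : E \in net n by case/and3P: ED.
have tw : twins rho d n E D = twins rho d n E D'.
  by rewrite /twins e1 e2.
rewrite -tw => idx.
have Dt : D \in twins rho d n E D by apply/(mem_twins _ _ En).
have D't : D' \in twins rho d n E D by rewrite tw; apply/(mem_twins _ _ En).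
by rewrite -(nth_index (0, 0) Dt) idx nth_index.
Qed.

Lemma exists_child a b n E : is_child rho d a b -> E \in net n ->
  (char_vec n E).1 = a.1 -> exists2 D, is_parent n E D & char_vec n.+1 D = b.
Proof.
move=> /asboolP[[[n' E'] D'] [E'D' ea eb]] En eE.
have key : same_key n' E' n E.
  by apply: char_vec_key => //; [case/and3P: E'D'|rewrite eE ea].
have [h1 h2] := transport_child key E'D'.
by exists (transport n' E' n E D') => //; rewrite h2.
Qed.

(** Independence of the chosen realization. [transport] carries one parent to the other, and by
    [child_uniq] the transported child is the other child; in normalized coordinates the equation
    for l becomes d_l - c_i = z - rho b_k, with z the coordinate of D.1, the same for both. *)
Lemma trans_mxE a b n E D i k : realizes a b (n, E, D) ->
  trans_mx rho d p a b i k =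
  if [pick l | E.1 - rho ^+ n * (nb a)`_i + rho ^+ n * d l
               == D.1 - rho ^+ n.+1 * (nb b)`_k] is Some l
  then (p ord0)^-1 * p l else 0.
Proof.
move=> real; rewrite /trans_mx.
have := @xgetPex _ (0%N, (0, 1), (0, 1)) (realizes a b) (ex_intro _ _ real).
case: (xget _ _) => -[n' E'] D' [E'D' ea' eb']; rewrite mxE.
have [ED ea eb] := real.
have key : same_key n E n' E'.
  by apply: char_vec_key; [case/and3P: ED|case/and3P: E'D'|rewrite ea ea'].
have [tED te] := transport_child key ED.
have -> : D' = transport n E n' E' D.
  by apply: (child_uniq E'D' tED); rewrite te eb eb'.
rewrite (@eq_pick _ _ (fun l => E.1 - rho ^+ n * (nb a)`_i + rho ^+ n * d l
               == D.1 - rho ^+ n.+1 * (nb b)`_k))// => l.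
rewrite -(inj_eq (can_inj (net_coordK n E))) -[RHS](inj_eq (can_inj (net_coordK n E))).
have e N F x y z : (F.1 - rho ^+ N * x + rho ^+ N * y == net_pt N F z - rho ^+ N.+1 * (nb b)`_k)
     = (y - x == z - rho * (nb b)`_k).
  rewrite /net_pt exprSr -mulrA -!addrA (inj_eq (addrI _)) -!mulrN -!mulrDr.
  by rewrite (inj_eq (mulfI (rnN N))) addrC.
rewrite /transport /= !(inj_eq (can_inj (net_coordK n E))) e.
by rewrite -{2}(net_coordK n E D.1) e.
Qed.

End Transport.

(** * Weights and transition matrices *)

Section Weights.
Context {R : realType} {m : nat}.
Variables (rho : R) (d p : 'I_m.+1 -> R).
Hypothesis H : unit_ifs rho d p.

Local Notation word n := (n.-tuple 'I_m.+1).
Local Notation S := (S_word rho d).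
Local Notation net := (net rho d).
Local Notation nbhd := (nbhd rho d).
Local Notation is_parent := (is_parent rho d).
Local Notation char_vec := (char_vec rho d).
Local Notation realizes := (realizes rho d).
Local Notation trans_mx := (trans_mx rho d p).
Local Notation path_mx := (path_mx rho d p).
Local Notation is_child := (is_child rho d).
Local Notation p0 := (p ord0).

Implicit Types (D E : R * R) (a b : charvec R) (P : pred (seq 'I_m.+1)).

Let rho0 : 0 < rho. Proof. by have /andP[] := ui_rho H. Qed.
Let rn0 n : 0 < rho ^+ n. Proof. exact: exprn_gt0. Qed.
Let rnN n : rho ^+ n != 0. Proof. by rewrite gt_eqF. Qed.
Let p0_gt0 : 0 < p0. Proof. exact: ui_p0 H _. Qed.

Definition pw (w : seq 'I_m.+1) : R := \prod_(l <- w) p l.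

Definition wt n P : R := \sum_(w : word n | P w) pw w.

Lemma pw_rcons w l : pw (rcons w l) = pw w * p l.
Proof. by rewrite /pw big_rcons. Qed.

Lemma pw_gt0 w : 0 < pw w.
Proof. by apply: prodr_gt0 => l _; apply: ui_p0 H _. Qed.

Lemma wtS n P :
  wt n.+1 P = \sum_(w : word n) pw w * \sum_(l | P (rcons w l)) p l.
Proof.
rewrite /wt big_tuple_rcons; apply: eq_bigr => w _.
by rewrite mulr_sumr; apply: eq_bigr => l _; rewrite pw_rcons.
Qed.

Lemma wt_mkcond n P : wt n P = \sum_(w : word n) pw w * (P w)%:R.
Proof.
by rewrite /wt big_mkcond; apply: eq_bigr => w _; case: (P w); rewrite ?mulr1 ?mulr0.
Qed.

Lemma wt_ge0 n P : 0 <= wt n P.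
Proof. by apply: sumr_ge0 => w _; apply/ltW/pw_gt0. Qed.

Lemma wt_gt0 n P (w : word n) : P w -> 0 < wt n P.
Proof.
move=> Pw; rewrite /wt (bigD1 w)//= ltr_wpDr ?pw_gt0//.
by apply: sumr_ge0 => ? _; apply/ltW/pw_gt0.
Qed.

Lemma wt_T n : wt n predT = 1.
Proof.
elim: n => [|n IH].
  by rewrite /wt (big_pred1 [tuple]) /pw ?big_nil// => w; rewrite tuple0 /= eqxx.
rewrite wtS -[RHS]IH; apply: eq_bigr => w _; rewrite (eq_bigl xpredT)// (ui_p1 H).
by rewrite mulr1.
Qed.

Lemma wt_le n P P' : (forall w : word n, P w -> P' w) -> wt n P <= wt n P'.
Proof.
move=> PP'; rewrite !wt_mkcond; apply: ler_sum => w _.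
rewrite ler_pM2l ?pw_gt0//; have := PP' w.
by case: (P w) => [/(_ isT) ->//|_]; case: (P' w).
Qed.

Lemma wt_split n P P1 P2 P3 : (forall w : word n, P w -> [|| P1 w, P2 w | P3 w]) ->
  wt n P <= wt n P1 + wt n P2 + wt n P3.
Proof.
move=> PP'; rewrite !wt_mkcond -!big_split; apply: ler_sum => w _ /=.
rewrite -!mulrDr ler_pM2l ?pw_gt0//; have := PP' w.
case: (P w) => [/(_ isT)|_]; last by rewrite !addr_ge0.
by case: (P1 w); case: (P2 w); case: (P3 w) => //= _; rewrite -!natrD ler_nat.
Qed.

Lemma sum_p_le1 (Pl : pred 'I_m.+1) : \sum_(l | Pl l) p l <= 1.
Proof.
rewrite -(ui_p1 H) [leLHS]big_mkcond; apply: ler_sum => l _.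
by case: ifP => // _; apply/ltW/(ui_p0 H).
Qed.

(* [A w] stands for "h is the left (resp. right) endpoint of S_w [0, 1]" and
   [C w] for "S_w [0, 1] covers the other side of h"; e0 is the letter whose
   similarity fixes that endpoint of [0, 1], and has the least weight. *)
Lemma boundary_weight (A C : pred (seq 'I_m.+1)) e0 n : p e0 = p0 ->
  ~~ A [::] ->
  (forall w l, A (rcons w l) -> l != e0 -> C w) ->
  (forall w, A (rcons w e0) -> A w) ->
  (forall w, C w -> exists l, C (rcons w l)) ->
  wt n A <= n%:R / p0 * wt n C.
Proof.
move=> pe0 A0 AC AA CC; elim: n => [|n IH].
  by rewrite mul0r mul0r /wt big_pred0// => w; rewrite tuple0; apply/negbTE.
have C1 : p0 * wt n C <= wt n.+1 C.
  rewrite wtS wt_mkcond mulr_sumr; apply: ler_sum => w _.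
  rewrite mulrCA ler_pM2l ?pw_gt0//.
  case Cw : (C w); last by rewrite mulr0 sumr_ge0// => l _; apply/ltW/(ui_p0 H).
  have [l Cl] := CC _ Cw; rewrite mulr1 (bigD1 l)//=.
  by rewrite -[leLHS]addr0 lerD ?(ui_pmin H)// sumr_ge0// => ? _; apply/ltW/(ui_p0 H).
(* A word in A extends a word in A by e0, at the exact cost p_0, or it extends a word in C. Since
   the weight of C loses at most the factor p_0 per level, the ratio of the weights of A and C grows
   by at most 1 / p_0 per level. A larger p e0 would make it grow geometrically in this estimate. *)
have A1 : wt n.+1 A <= p0 * wt n A + wt n C.
  rewrite wtS !wt_mkcond mulr_sumr -big_split; apply: ler_sum => w _ /=.
  rewrite mulrCA -mulrDr ler_pM2l ?pw_gt0//.
  case Cw : (C w) => /=; last first.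
    rewrite addr0 big_mkcond (bigD1 e0)//= big1 ?addr0; last first.
      by move=> l le0; case: ifP => // /AC /(_ le0); rewrite Cw.
    by case: ifP => [/AA ->|_]; [rewrite pe0 /= mulr1|rewrite mulr_ge0// ltW].
  by apply: le_trans (sum_p_le1 _) _; rewrite lerDr mulr_ge0// ltW.
apply: le_trans A1 _.
have h1 : p0 * wt n A <= n%:R / p0 * wt n.+1 C.
  apply: (@le_trans _ _ (p0 * (n%:R / p0 * wt n C))); first by rewrite ler_pM2l.
  by rewrite mulrCA ler_wpM2l// divr_ge0// ltW.
have h2 : wt n C <= p0^-1 * wt n.+1 C by rewrite -ler_pdivrMl ?invr_gt0// invrK.
by rewrite -natr1 mulrDl mulrDl lerD// mul1r.
Qed.

Definition cover_wt n D := wt n (fun w => sub_itv D (S w 0, S w 1)).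

Lemma cover_wt_gt0 n D : D \in net n -> 0 < cover_wt n D.
Proof.
move=> Dn; have /netP[D1 D2 ltD _] := Dn.
have [w hw] : exists w : word n, S w 0 <= D.1 < S w 1.
  apply: (exists_cover_right H).
  have /andP[-> _] := endpoints01 H D1; have /andP[_ ?] := endpoints01 H D2.
  exact: lt_le_trans ltD _.
by apply: (wt_gt0 (w := w)); rewrite cover_net_left.
Qed.

Lemma cover_wt_le1 n D : cover_wt n D <= 1.
Proof. by rewrite -(wt_T n); apply: wt_le. Qed.

Lemma cover_wt_parent n E D : is_parent n E D ->
  p0 * cover_wt n E <= cover_wt n.+1 D <= cover_wt n E.
Proof.
move=> ED; rewrite /cover_wt wtS wt_mkcond mulr_sumr; apply/andP; split.
  apply: ler_sum => w _; rewrite mulrCA ler_pM2l ?pw_gt0//.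
  have [cov|_] := boolP (sub_itv E _); last by rewrite mulr0 sumr_ge0// => l _; apply/ltW/(ui_p0 H).
  have [l hl] := cover_child H ED cov; rewrite mulr1 (bigD1 l)//=.
  by rewrite -[leLHS]addr0 lerD ?(ui_pmin H)// sumr_ge0// => ? _; apply/ltW/(ui_p0 H).
apply: ler_sum => w _; rewrite ler_pM2l ?pw_gt0//.
have [_|ncov] := boolP (sub_itv E _); first exact: sum_p_le1.
by rewrite big_pred0// => l; apply: contraNF ncov => /(cover_parent H ED).
Qed.

(** If S_(w l) [0, 1] ends at D.1 and l is not the last letter, then S_w [0, 1] continues to the
    right of D.1. Only the last letter keeps the right endpoint, which is where p_m = p_0 is
    used. *)
Lemma left_endpoint_wt n D : D \in net n ->
  wt n (fun w => S w 1 == D.1) <= n%:R / p0 * cover_wt n D.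
Proof.
move=> Dn; have /netP[_ D2 ltD _] := Dn.
have D1lt : D.1 < 1 by apply: lt_le_trans ltD _; have /andP[] := endpoints01 H D2.
apply: (@le_trans _ _ (n%:R / p0 * wt n (fun w => S w 0 <= D.1 < S w 1))); last first.
  rewrite ler_wpM2l ?divr_ge0 ?(ltW p0_gt0)//; apply: wt_le => w hw.
  by rewrite cover_net_left.
apply: (boundary_weight (e0 := ord_max)).
- by rewrite (ui_pmax H).
- by rewrite /= gt_eqF.
- move=> w l; rewrite S_rcons1 S_word1 => /eqP <- lm.
  rewrite lerDl ltrD2l mulr_ge0 ?addr_ge0 ?(d_ge0 H) ?(ltW (rn0 _)) ?(ltW rho0)//=.
  rewrite gtr_pMr// -ltrBrDl -(ui_dm H) (ui_d H)//.
  by rewrite ltn_neqAle lm -ltnS ltn_ord.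
- by move=> w; rewrite S_rcons1 (ui_dm H) subrKC mulr1 S_word1.
- by move=> w; apply: extend_right H _ _.
Qed.

Lemma right_endpoint_wt n D : D \in net n ->
  wt n (fun w => S w 0 == D.2) <= n%:R / p0 * cover_wt n D.
Proof.
move=> Dn; have /netP[D1 _ ltD _] := Dn.
have D2gt : 0 < D.2 by apply: le_lt_trans ltD; have /andP[] := endpoints01 H D1.
apply: (@le_trans _ _ (n%:R / p0 * wt n (fun w => S w 0 < D.2 <= S w 1))); last first.
  rewrite ler_wpM2l ?divr_ge0 ?(ltW p0_gt0)//; apply: wt_le => w hw.
  by rewrite cover_net_right.
apply: (boundary_weight (e0 := ord0)) => //.
- by rewrite /= lt_eqF.
- move=> w l; rewrite S_rcons0 S_word1 => /eqP <- l0.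
  rewrite ltrDl lerD2l mulr_gt0//=; last first.
    by rewrite -(ui_d0 H) (ui_d H)// lt0n.
  rewrite ger_pMr//; apply: le_trans (d_le1 H l).
  by rewrite lerDr ltW.
- by move=> w; rewrite S_rcons0 (ui_d0 H) mulr0 addr0.
- by move=> w; apply: extend_left H _ _.
Qed.

(* As k varies, this is the row vector p_0 ^ n T(gamma_0, ..., gamma_n). *)
Definition nb_wt n D a (k : nat) : R :=
  wt n (fun w => S w 0 == D.1 - rho ^+ n * (nb a)`_k).

Lemma cover_nbhd n D c (w : word n) : c \in nbhd n D ->
  S w 0 = D.1 - rho ^+ n * c -> sub_itv D (S w 0, S w 1).
Proof.
move=> /(mem_nbhd H)[w' cov e] e'.
by move: cov; rewrite !S_word1 !size_tuple e e'.
Qed.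

Lemma nbhd_index n D (w : word n) : sub_itv D (S w 0, S w 1) ->
  exists k : 'I_(size (nbhd n D)),
    forall k' : 'I_(size (nbhd n D)),
      (S w 0 == D.1 - rho ^+ n * (nbhd n D)`_k') = (k' == k).
Proof.
move=> cov; pose c := rho ^- n * (D.1 - S w 0).
have ec : S w 0 = D.1 - rho ^+ n * c by rewrite mulrA divff// mul1r subKr.
have cn : c \in nbhd n D by apply/(mem_nbhd H); exists w.
have ki : (index c (nbhd n D) < size (nbhd n D))%N by rewrite index_mem.
exists (Ordinal ki) => k'; rewrite ec (inj_eq (addrI _)) (inj_eq oppr_inj).
rewrite (inj_eq (mulfI (rnN n))) -{1}(nth_index 0 cn) nth_uniq//.
  by rewrite -val_eqE eq_sym.
by rewrite (sorted_uniq lt_trans (@ltxx _ _))//; exact: sorted_nbhd.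
Qed.

Lemma nb_wt_gt0 n D a k : char_vec n D = a -> (k < size (nb a))%N ->
  0 < nb_wt n D a k.
Proof.
move=> <- ka; have /(mem_nbhd H)[w _ e] := mem_nth 0 ka.
by apply: (wt_gt0 (w := w)); rewrite e.
Qed.

Lemma sum_nb_index n D (w : word n) (F : 'I_(size (nbhd n D)) -> R) :
  ~~ sub_itv D (S w 0, S w 1) ->
  \sum_(k < size (nbhd n D) | S w 0 == D.1 - rho ^+ n * (nbhd n D)`_k) F k = 0.
Proof.
move=> ncov; rewrite big_pred0// => k; apply: contraNF ncov => /eqP.
by apply: cover_nbhd; rewrite mem_nth.
Qed.

Lemma cover_wt_sum n D a : char_vec n D = a ->
  cover_wt n D = \sum_(k < size (nb a)) nb_wt n D a k.
Proof.
move=> <-; rewrite [LHS]big_mkcond /nb_wt /wt (exchange_big_dep xpredT)//=.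
apply: eq_bigr => w _; case: ifPn => [cov|]; last by move/sum_nb_index ->.
by have [k hk] := nbhd_index cov; rewrite (big_pred1 k).
Qed.

(** The factor p_0 undoes the normalization of the matrix. A word that does not cover E contributes
    to neither side; one that does is the i-th neighbour for a single i, and at most one letter, d
    being injective, extends it to the k-th neighbour of D. *)
Lemma nb_wtS a b n E D (k : 'I_(size (nb b))) : realizes a b (n, E, D) ->
  nb_wt n.+1 D b k = p0 * \sum_(i < size (nb a)) nb_wt n E a i * trans_mx a b i k.
Proof.
move=> real; have [ED ea eb] := real; rewrite /nb_wt.
under [in RHS]eq_bigr do rewrite /wt big_distrl/=.
rewrite (exchange_big_dep xpredT)//= mulr_sumr wtS; apply: eq_bigr => w _.
rewrite -mulr_sumr mulrCA; congr (_ * _); rewrite -{}ea in real *.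
have [cov|ncov] := boolP (sub_itv E (S w 0, S w 1)); last first.
  rewrite sum_nb_index// mulr0 big_pred0// => l; apply: contraNF ncov => /eqP.
  have kb : (nb b)`_k \in nbhd n.+1 D by rewrite [nbhd _ _](_ : _ = nb b) ?mem_nth// -eb.
  move/(cover_nbhd (w := rcons_tuple w l) kb) => /= hD.
  exact: (cover_parent H ED hD).
have [i hi] := nbhd_index cov; rewrite (big_pred1 i)// (trans_mxE H _ _ real).
have := hi i; rewrite eqxx => /eqP ei.
case: pickP => [l /eqP hl|hl].
  rewrite mulrA divff ?gt_eqF// mul1r (big_pred1 l)// => l'.
  rewrite S_rcons0 size_tuple ei -hl (inj_eq (addrI _)) (inj_eq (mulfI (rnN n))).
  by rewrite (inj_eq (d_inj H)).
rewrite mulr0 big_pred0// => l; rewrite S_rcons0 size_tuple ei.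
exact: hl l.
Qed.

(** A nonzero entry is p_l / p_0, and p_0 is the least probability. *)
Lemma trans_mx_01 a b i k : trans_mx a b i k = 0 \/ 1 <= trans_mx a b i k.
Proof.
rewrite /trans_mx; case: (xget _ _) => -[n E] D; rewrite mxE.
case: pickP => [l _|_]; [right|by left].
by rewrite ler_pdivlMl// mulr1 (ui_pmin H).
Qed.

Lemma trans_mx_ge1 a b n E D (w : word n) l
    (i : 'I_(size (nb a))) (k : 'I_(size (nb b))) : realizes a b (n, E, D) ->
  S w 0 = E.1 - rho ^+ n * (nb a)`_i ->
  S (rcons w l) 0 = D.1 - rho ^+ n.+1 * (nb b)`_k -> 1 <= trans_mx a b i k.
Proof.
move=> real ei ek; rewrite (trans_mxE H _ _ real); case: pickP => [l' _|/(_ l)].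
  by rewrite ler_pdivlMl// mulr1 (ui_pmin H).
by rewrite -ei -ek S_rcons0 size_tuple eqxx.
Qed.

(** A word covering the parent has an extension covering the child, so no row vanishes; conversely a
    word covering the child extends one covering the parent, so no column vanishes ([trans_mx_col]).
    Hence positivity survives multiplication by transition matrices on either side. *)
Lemma trans_mx_row a b (i : 'I_(size (nb a))) : is_child a b ->
  exists k, 1 <= trans_mx a b i k.
Proof.
move=> /asboolP[[[n E] D] real]; have [ED ea eb] := real.
have : (nb a)`_i \in nbhd n E by rewrite [nbhd _ _](_ : _ = nb a) ?mem_nth// -ea.
case/(mem_nbhd H) => w cov ei; have [l hl] := cover_child H ED cov.
have [k hk] := nbhd_index (w := rcons_tuple w l) hl.
have e : nbhd n.+1 D = nb b by rewrite -eb.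
move: k hk; rewrite e => k /(_ k); rewrite eqxx => /eqP ek.
by exists k; apply: trans_mx_ge1 real ei ek.
Qed.

Lemma trans_mx_col a b (k : 'I_(size (nb b))) : is_child a b ->
  exists i, 1 <= trans_mx a b i k.
Proof.
move=> /asboolP[[[n E] D] real]; have [ED ea eb] := real.
have : (nb b)`_k \in nbhd n.+1 D by rewrite [nbhd _ _](_ : _ = nb b) ?mem_nth// -eb.
case/(mem_nbhd H) => w; have [w' [l ->]] := tuple_rconsP w => hl ek.
have [i hi] := nbhd_index (cover_parent H ED hl).
have e : nbhd n E = nb a by rewrite -ea.
move: i hi; rewrite e => i /(_ i); rewrite eqxx => /eqP ei.
by exists i; apply: trans_mx_ge1 real ei ek.
Qed.

End Weights.

(** * Paths and nested net intervals *)

Section Paths.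
Context {R : realType} {m : nat}.
Variables (rho : R) (d p : 'I_m.+1 -> R).
Hypothesis H : unit_ifs rho d p.

Local Notation net := (net rho d).
Local Notation is_parent := (is_parent rho d).
Local Notation char_vec := (char_vec rho d).
Local Notation trans_mx := (trans_mx rho d p).
Local Notation path_mx := (path_mx rho d p).
Local Notation is_child := (is_child rho d).
Local Notation p0 := (p ord0).
Local Notation sz a := (size (nb a)).

Implicit Types (D E : R * R) (a b : charvec R) (s t u : seq (charvec R)).

Let p0_gt0 : 0 < p0. Proof. exact: ui_p0 H _. Qed.

(* Entries indexed by natural numbers, so that concatenating paths involves no
   casts between matrix types. *)
Definition trans_entry a b (i k : nat) : R :=
  match insub i : option 'I_(sz a), insub k : option 'I_(sz b) with
  | Some i', Some k' => trans_mx a b i' k'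
  | _, _ => 0
  end.

Fixpoint path_entry a s (i k : nat) : R :=
  if s is b :: s' then \sum_(j < sz b) trans_entry a b i j * path_entry b s' j k
  else (i == k)%:R.

Lemma trans_entryE a b (i : 'I_(sz a)) (k : 'I_(sz b)) :
  trans_entry a b i k = trans_mx a b i k.
Proof. by rewrite /trans_entry !valK. Qed.

Lemma path_entryE a s (i : 'I_(sz a)) (k : 'I_(sz (last a s))) :
  path_entry a s i k = path_mx a s i k.
Proof.
elim: s a i k => [|b s IH] a i k /=; first by rewrite mxE.
rewrite mxE; apply: eq_bigr => j _; by rewrite trans_entryE IH.
Qed.

Definition entry_ok (x : R) := x = 0 \/ 1 <= x.

Lemma entry_okD x y : entry_ok x -> entry_ok y -> entry_ok (x + y).
Proof. by case=> [->|hx] [->|hy]; rewrite /entry_ok; lra. Qed.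

Lemma entry_okM x y : entry_ok x -> entry_ok y -> entry_ok (x * y).
Proof.
case=> [->|hx] [->|hy]; rewrite ?mul0r ?mulr0; [by left..|right].
by rewrite mulr_ege1.
Qed.

Lemma entry_ok_ge0 x : entry_ok x -> 0 <= x.
Proof. by case=> [->//|]; apply: le_trans. Qed.

Lemma trans_entry_ok a b i k : entry_ok (trans_entry a b i k).
Proof.
rewrite /trans_entry; case: (insub i) => [i'|]; last by left.
by case: (insub _) => [k'|]; [exact: trans_mx_01|left].
Qed.

Lemma path_entry_ok a s i k : entry_ok (path_entry a s i k).
Proof.
elim: s a i => [|b s IH] a i /=.
  by case: eqP => _; [right|left].
elim/big_ind: _ => [|x y|j _]; [by left|exact: entry_okD|].
by apply: entry_okM => //; exact: trans_entry_ok.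
Qed.

Lemma path_entry_ge0 a s i k : 0 <= path_entry a s i k.
Proof. exact/entry_ok_ge0/path_entry_ok. Qed.

Lemma path_entry_cat a s t i k : (i < sz a)%N ->
  path_entry a (s ++ t) i k =
  \sum_(j < sz (last a s)) path_entry a s i j * path_entry (last a s) t j k.
Proof.
elim: s a i => [|b s IH] a i ia /=.
  rewrite (bigD1 (Ordinal ia))//= eqxx mul1r big1 ?addr0// => j.
  by rewrite -val_eqE /= eq_sym => /negbTE ->; rewrite mul0r.
under eq_bigr do rewrite IH// mulr_sumr.
rewrite exchange_big; apply: eq_bigr => j _ /=.
by rewrite mulr_suml; apply: eq_bigr => l _; rewrite mulrA.
Qed.

Lemma path_entry_ge a s t i j k : (i < sz a)%N -> (j < sz (last a s))%N ->
  path_entry a s i j * path_entry (last a s) t j k <= path_entry a (s ++ t) i k.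
Proof.
move=> ia js; rewrite path_entry_cat// (bigD1 (Ordinal js))//= lerDl.
by apply: sumr_ge0 => l _; rewrite mulr_ge0 ?path_entry_ge0.
Qed.

Lemma path_entry_row a s i : path is_child a s -> (i < sz a)%N ->
  exists2 k, (k < sz (last a s))%N & 1 <= path_entry a s i k.
Proof.
elim: s a i => [|b s IH] a i /=; first by move=> _ ia; exists i; rewrite ?eqxx.
move=> /andP[ab bs] ia.
have [j hj] := trans_mx_row H (Ordinal ia) ab.
have [k kb hk] := IH _ j bs (ltn_ord j); exists k => //.
rewrite (bigD1 j)//= -(mulr1 1) ler_wpDr ?ler_pM//.
  apply: sumr_ge0 => l _; rewrite mulr_ge0 ?path_entry_ge0//.
  exact/entry_ok_ge0/trans_entry_ok.
by rewrite (trans_entryE (Ordinal ia)).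
Qed.

Definition all_ge1 a s :=
  forall i k, (i < sz a)%N -> (k < sz (last a s))%N -> 1 <= path_entry a s i k.

Lemma strictly_positive_all_ge1 a s : strictly_positive (path_mx a s) <-> all_ge1 a s.
Proof.
split=> [pos i k ia ks|pos i k].
  have := pos (Ordinal ia) (Ordinal ks); rewrite -path_entryE /=.
  by case: (path_entry_ok a s i k) => // ->; rewrite ltxx.
by rewrite -path_entryE (lt_le_trans ltr01)// pos.
Qed.

Lemma all_ge1_catl a s t : path is_child a s -> all_ge1 (last a s) t ->
  all_ge1 a (s ++ t).
Proof.
move=> as_ pos i k ia; rewrite last_cat => kt.
have [j js hj] := path_entry_row as_ ia.
apply: le_trans (path_entry_ge _ _ ia js).
by rewrite -(mulr1 1) ler_pM// pos.
Qed.

Lemma path_entry_col a s k : path is_child a s -> (k < sz (last a s))%N ->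
  exists2 i, (i < sz a)%N & 1 <= path_entry a s i k.
Proof.
elim: s a => [|b s IH] a /=; first by move=> _ ia; exists k; rewrite ?eqxx.
move=> /andP[ab bs] ks; have [j jb hj] := IH _ bs ks.
have [i hi] := trans_mx_col H (Ordinal jb) ab; exists i => //.
have e : 1 <= path_entry a [:: b] i j.
  rewrite -trans_entryE /= in hi.
  rewrite /= (bigD1 (Ordinal jb))//= eqxx mulr1 big1 ?addr0//.
  by move=> l; rewrite -val_eqE /= => /negbTE ->; rewrite mulr0.
apply: le_trans (@path_entry_ge a [:: b] s i j k (ltn_ord i) jb).
by rewrite -(mulr1 1) ler_pM.
Qed.

Lemma all_ge1_catr a s t : path is_child (last a s) t -> all_ge1 a s ->
  all_ge1 a (s ++ t).
Proof.
move=> st pos i k ia; rewrite last_cat => kt.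
have [j js hj] := path_entry_col st kt.
apply: le_trans (path_entry_ge _ _ ia js).
by rewrite -(mulr1 1) ler_pM// pos.
Qed.

Definition nrm a s : R :=
  \sum_(i < sz a) \sum_(k < sz (last a s)) path_entry a s i k.

Lemma nrm_ge1 a s : path is_child a s -> (0 < sz a)%N -> 1 <= nrm a s.
Proof.
move=> as_ a0; have [k ks hk] := path_entry_row as_ a0.
rewrite /nrm (bigD1 (Ordinal a0))//= (bigD1 (Ordinal ks))//= -addrA.
rewrite ler_wpDr// addr_ge0//; first by apply: sumr_ge0 => ? _; apply: path_entry_ge0.
by do 2![apply: sumr_ge0 => ? _]; apply: path_entry_ge0.
Qed.

Lemma nrm_cat_le a s t : nrm a (s ++ t) <= nrm a s * nrm (last a s) t.
Proof.
rewrite /nrm mulr_suml; apply: ler_sum => i _; rewrite last_cat.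
under eq_bigr do rewrite path_entry_cat//.
rewrite exchange_big mulr_suml; apply: ler_sum => j _ /=.
rewrite -mulr_sumr ler_wpM2l ?path_entry_ge0// [leRHS](bigD1 j)//= lerDl.
by do 2![apply: sumr_ge0 => ? _]; apply: path_entry_ge0.
Qed.

(** If all entries of the middle matrix were 1, the sum of the entries of the product would be
    exactly the product of the two outer sums. So norms are supermultiplicative across a positive
    block. *)
Lemma nrm_cat_ge a s t u : all_ge1 (last a s) t ->
  nrm a s * nrm (last (last a s) t) u <= nrm a (s ++ t ++ u).
Proof.
move=> pos; rewrite /nrm mulr_suml; apply: ler_sum => i _; rewrite !last_cat.
under [leRHS]eq_bigr do rewrite path_entry_cat//.
rewrite [leRHS]exchange_big mulr_suml; apply: ler_sum => j _ /=.
rewrite -mulr_sumr ler_wpM2l ?path_entry_ge0//.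
rewrite exchange_big; apply: ler_sum => k _ /=.
rewrite path_entry_cat//; apply: ler_sum => l _.
by rewrite ler_peMl ?path_entry_ge0// pos.
Qed.

Definition net_chain (Ds : nat -> R * R) (g : nat -> charvec R) :=
  forall n, is_parent n (Ds n) (Ds n.+1) /\ g n = char_vec n (Ds n).

Lemma net_chain_net Ds g n : net_chain Ds g -> Ds n \in net n.
Proof. by case/(_ n) => /and3P[]. Qed.

Lemma net_chain_child Ds g n : net_chain Ds g -> is_child (g n) (g n.+1).
Proof.
move=> ch; have [h e] := ch n; have [_ e'] := ch n.+1.
by apply/asboolP; exists (n, Ds n, Ds n.+1); split.
Qed.

(** The tail of a path whose head is [g n], hence the shift by one in the index. *)
Definition seg (g : nat -> charvec R) n k := [seq g (n + i.+1)%N | i <- iota 0 k].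

Lemma seg0 g n k : seg g n k.+1 = g n.+1 :: seg g n.+1 k.
Proof.
rewrite /seg /= addn1; congr cons; rewrite (iotaDl 1 0 k) -map_comp.
by apply: eq_map => i /=; rewrite add1n addSnnS.
Qed.

Lemma size_seg g n k : size (seg g n k) = k.
Proof. by rewrite size_map size_iota. Qed.

Lemma seg_cat g n k l : seg g n (k + l) = seg g n k ++ seg g (n + k) l.
Proof.
rewrite /seg iotaD map_cat add0n -[in iota k l](addn0 k) iotaDl -map_comp.
by congr (_ ++ _); apply: eq_map => i /=; rewrite -addnS addnA.
Qed.

Lemma last_seg g n k : last (g n) (seg g n k) = g (n + k)%N.
Proof.
by elim: k n => [|k IH] n; rewrite ?addn0// seg0 /= IH addSnnS.
Qed.

Lemma path_seg (e : rel (charvec R)) g n k :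
  (forall i, e (g (n + i)%N) (g (n + i).+1)) -> path e (g n) (seg g n k).
Proof.
elim: k n => // k IH n he; rewrite seg0 /=; have := he 0%N; rewrite addn0 => -> /=.
by apply: IH => i; rewrite addSnnS.
Qed.

Lemma nb_wt_path Ds g n k i : net_chain Ds g -> (i < sz (g (n + k)%N))%N ->
  nb_wt rho d p (n + k) (Ds (n + k)%N) (g (n + k)%N) i =
  p0 ^+ k * \sum_(j < sz (g n))
    nb_wt rho d p n (Ds n) (g n) j * path_entry (g n) (seg g n k) j i.
Proof.
move=> ch; elim: k n => [|k IH] n.
  rewrite addn0 => ig; rewrite mul1r (bigD1 (Ordinal ig))//= eqxx mulr1 big1 ?addr0//.
  by move=> l; rewrite -val_eqE /= => /negbTE ->; rewrite mulr0.
rewrite addnS -addSn => ig; rewrite IH// exprS -mulrA mulrCA; congr (_ * _).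
have [h e] := ch n; have [h' e'] := ch n.+1.
under eq_bigr do rewrite (nb_wtS H _ (And3 h (esym e) (esym e'))) -mulrA.
rewrite -mulr_sumr; congr (_ * _); rewrite seg0 /=.
under eq_bigr do rewrite mulr_suml.
rewrite exchange_big; apply: eq_bigr => j _ /=; rewrite mulr_sumr.
by apply: eq_bigr => l _; rewrite trans_entryE mulrA.
Qed.

(** The neighbour weights at level n lie between their minimum c and 1, so replacing them by 1 turns
    the weighted sum of matrix entries into the norm. The constant c depends on the starting level n
    but not on k. *)
Lemma cover_wt_nrm Ds g n : net_chain Ds g -> exists2 c : R, 0 < c & forall k,
  c * (p0 ^+ k * nrm (g n) (seg g n k)) <= cover_wt rho d p (n + k) (Ds (n + k)%N) <=
  p0 ^+ k * nrm (g n) (seg g n k).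
Proof.
move=> ch; have [_ e] := ch n.
have sumE k : cover_wt rho d p (n + k) (Ds (n + k)%N) = p0 ^+ k *
    \sum_(j < sz (g n)) \sum_(i < sz (g (n + k)%N))
      nb_wt rho d p n (Ds n) (g n) j * path_entry (g n) (seg g n k) j i.
  have [_ e'] := ch (n + k)%N; rewrite (cover_wt_sum H (esym e')).
  rewrite exchange_big mulr_sumr; apply: eq_bigr => i _.
  by rewrite (nb_wt_path ch).
have [c c0 hc] : exists2 c : R, 0 < c &
    forall j : 'I_(sz (g n)), c <= nb_wt rho d p n (Ds n) (g n) j.
  exists (\big[Order.min/1]_(j < sz (g n)) nb_wt rho d p n (Ds n) (g n) j).
    elim/big_ind: _ => // [x y x0 y0|j _]; first by rewrite lt_min x0.
    exact: (nb_wt_gt0 H (esym e) (ltn_ord j)).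
  by move=> j; rewrite (bigD1 j)//= ge_min lexx.
exists c => // k; rewrite sumE /nrm last_seg; apply/andP; split.
  rewrite mulrCA ler_pM2l ?exprn_gt0//.
  rewrite mulr_sumr; apply: ler_sum => j _; rewrite mulr_sumr; apply: ler_sum => i _.
  by rewrite ler_wpM2r ?path_entry_ge0.
rewrite ler_pM2l ?exprn_gt0//; apply: ler_sum => j _; apply: ler_sum => i _.
rewrite -[leRHS]mul1r ler_wpM2r ?path_entry_ge0//.
apply: le_trans (cover_wt_le1 H n (Ds n)).
rewrite (cover_wt_sum H (esym e)) (bigD1 j)//= lerDl.
by apply: sumr_ge0 => ? _; apply: wt_ge0 H _ _.
Qed.

Lemma net0_mem D : D \in net 0 -> D = (0, 1).
Proof. by rewrite net0 mem_seq1 => /eqP. Qed.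

Lemma symbolic_rep_chain x g : symbolic_rep rho d x g <->
  exists2 Ds, net_chain Ds g & forall n, x \in `[(Ds n).1, (Ds n).2].
Proof.
split=> [[Ds hD]|[Ds ch xD]].
  by exists Ds => n; have [? ? ? ?] := hD n.
by exists Ds => n; have [h1 h2] := ch n; split => //; apply: net_chain_net ch.
Qed.

Lemma net_chain_le Ds g n k : net_chain Ds g ->
  (Ds n).1 <= (Ds (n + k)%N).1 /\ (Ds (n + k)%N).2 <= (Ds n).2.
Proof.
move=> ch; elim: k => [|k [h1 h2]]; first by rewrite addn0.
have [/and3P[_ _ /andP[h3 h4]] _] := ch (n + k)%N; rewrite addnS.
by split; [exact: le_trans h3|exact: le_trans h2].
Qed.

(** Admissibility of consecutive letters suffices: [exists_child] realizes the next letter inside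
    whichever interval realizes the current one. The supremum of the left endpoints lies in all the
    nested intervals. *)
Lemma exists_symbolic_rep (g : nat -> charvec R) : g 0%N = char_vec 0 (0, 1) ->
  (forall n, is_child (g n) (g n.+1)) -> exists x, symbolic_rep rho d x g.
Proof.
move=> g0 gc; pose next n D := xget (0, 1)
  [set D' | is_parent n D D' /\ char_vec n.+1 D' = g n.+1].
pose Ds := fix Ds n := if n is n'.+1 then next n' (Ds n') else (0, 1) : R * R.
have chain n : Ds n \in net n /\ char_vec n (Ds n) = g n.
  elim: n => [|n [Dn e]]; first by rewrite net0 mem_seq1 eqxx g0.
  have [D pD eD] := exists_child H (gc n) Dn (congr1 fst e).
  have [/and3P[_ h _] h'] : [set D' | is_parent n (Ds n) D' /\
      char_vec n.+1 D' = g n.+1] (Ds n.+1).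
    by apply: (@xgetPex _ (0, 1) _ (ex_intro _ D (conj pD eD))).
  by split.
have ch : net_chain Ds g.
  move=> n; have [Dn e] := chain n; split => //.
  have [D pD eD] := exists_child H (gc n) Dn (congr1 fst e).
  have [] : [set D' | is_parent n (Ds n) D' /\
      char_vec n.+1 D' = g n.+1] (Ds n.+1).
    by apply: (@xgetPex _ (0, 1) _ (ex_intro _ D (conj pD eD))).
  by [].
have le12 i j : (Ds i).1 <= (Ds j).2.
  have [h1 _] := net_chain_le i j ch; have [_ h2] := net_chain_le j i ch.
  rewrite addnC in h2; apply: le_trans h1 (le_trans (ltW _) h2).
  exact: net_lt (net_chain_net _ ch).
exists (sup [set (Ds n).1 | n in [set: nat]]); apply/symbolic_rep_chain.
exists Ds => // n; rewrite in_itv /=; apply/andP; split.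
  apply: ub_le_sup; last by exists n.
  by exists (Ds 0%N).2 => _ [k _ <-].
apply: ge_sup; first by exists (Ds 0%N).1, 0%N.
by move=> _ [k _ <-].
Qed.

(** The letter at J is the head of the cycle, so index J already belongs to the periodic part. The
    cycle is read from [belast], in the form required by [has_period]. *)
Definition cycle_from (g : nat -> charvec R) J s (j : nat) : charvec R :=
  if (j < J)%N then g j else nth (g J) (belast (g J) s) ((j - J) %% size s).

Lemma nth_belast_last a s i : last a s = a -> s <> [::] -> (i < size s)%N ->
  nth a (belast a s) (i.+1 %% size s) = nth a s i.
Proof.
move=> la; case: s la => // b s la _ il.
have e : nth a (b :: s) i = nth a (rcons (belast a (b :: s)) (last a (b :: s))) i.+1.
  by rewrite -lastI.
rewrite e nth_rcons size_belast.
have [lt|ge] := ltnP i.+1 (size (b :: s)); first by rewrite modn_small.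
have -> : i.+1 = size (b :: s) by apply/eqP; rewrite eqn_leq il.
by rewrite modnn eqxx la.
Qed.

Lemma cycle_fromD g J s k : cycle_from g J s (J + k) =
  nth (g J) (belast (g J) s) (k %% size s).
Proof. by rewrite /cycle_from ltnNge leq_addr /= addKn. Qed.

Lemma cycle_from_lt g J s j : s <> [::] -> (j <= J)%N -> cycle_from g J s j = g j.
Proof.
move=> s0; rewrite leq_eqVlt => /orP[/eqP ->|]; last by rewrite /cycle_from => ->.
by rewrite -{2}(addn0 J) cycle_fromD mod0n; case: s s0.
Qed.

Lemma cycle_from_child g J s : s <> [::] -> last (g J) s = g J ->
  path is_child (g J) s -> (forall j, (j < J)%N -> is_child (g j) (g j.+1)) ->
  forall j, is_child (cycle_from g J s j) (cycle_from g J s j.+1).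
Proof.
move=> s0 ls ps pre j; have [jJ|Jj] := ltnP j J.
  by rewrite !cycle_from_lt ?(ltnW jJ)//; apply: pre.
rewrite -(subnKC Jj); set k := (j - J)%N; rewrite -addnS !cycle_fromD.
have L0 : (0 < size s)%N by case: (s) s0.
have il := ltn_pmod k L0; rewrite -[k.+1]addn1 -modnDml addn1 nth_belast_last//.
have := pathP (g J) ps _ il; congr (is_child _ _).
by rewrite lastI nth_rcons size_belast il.
Qed.

Lemma seg_cycle_from g J s k : s <> [::] -> last (g J) s = g J ->
  seg (cycle_from g J s) J (k * size s) = flatten (nseq k s).
Proof.
move=> s0 ls; have L0 : (0 < size s)%N by case: (s) s0.
elim: k => // k IH; rewrite -addn1 mulnDl mul1n seg_cat IH nseqD flatten_cat.
congr (_ ++ _); rewrite /= cats0; apply: (@eq_from_nth _ (g J)); first exact: size_seg.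
move=> i; rewrite size_seg => il; rewrite (nth_map 0%N) ?size_iota// nth_iota// add0n.
by rewrite -addnA cycle_fromD modnMDl nth_belast_last.
Qed.

End Paths.

(** * Rates and upper limits *)

(* Fekete's lemma. *)
Lemma subadditive_rate (R : realType) (f : nat -> R) (A : R) :
  (forall k l, f (k + l)%N <= f k + f l) -> 0 <= A ->
  (forall k, A * k%:R <= f k) ->
  exists lam, [/\ A <= lam, lam <= f 1%N, forall k, lam * k%:R <= f k &
    forall e, 0 < e -> exists K, forall k, f k <= (lam + e) * k%:R + K].
Proof.
move=> fD A0 fA; pose E := [set f k.+1 / k.+1%:R | k in [set: nat]].
have lbE : lbound E A.
  by move=> _ [k _ <-]; rewrite ler_pdivlMr.
have hE : has_inf E by split; [exists (f 1%N / 1), 0%N|exists A].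
have infP k : inf E <= f k.+1 / k.+1%:R by apply: ge_inf; [exists A|exists k].
have AE : A <= inf E by apply: lb_le_inf => //; case: hE.
exists (inf E); split => //.
- by have := infP 0%N; rewrite divr1.
- case=> [|k]; first by rewrite mulr0 -(mulr0 A); apply: fA 0%N.
  by rewrite -ler_pdivlMr.
move=> e e0; have [_ [k0 _ <-] hk] := inf_adherent e0 hE.
set N := k0.+1 in hk; set lam := inf E in AE hk *.
have fN : f N <= (lam + e) * N%:R by rewrite -ler_pdivrMr// ltW.
(* With k = q N + r, the q blocks of length N cost at most (lam + e) N each, and this sum bounds f r
   for every remainder r < N. *)
exists (\sum_(i < N) `|f i|) => k.
rewrite (divn_eq k N); set q := (k %/ N)%N; set r := (k %% N)%N.
have fr : f r <= \sum_(i < N) `|f i|.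
  have rN : (r < N)%N by apply: ltn_pmod.
  rewrite (bigD1 (Ordinal rN))//=; apply: le_trans (ler_norm _) _.
  by rewrite lerDl sumr_ge0.
have fq : f (q * N + r)%N <= q%:R * f N + f r.
  elim: (q) => [|i IH]; first by rewrite mul0n mul0r !add0r.
  rewrite mulSn -addnA; apply: le_trans (fD _ _) _; rewrite -natr1; lra.
have le0 : 0 <= lam + e by lra.
have h1 : q%:R * f N <= q%:R * ((lam + e) * N%:R) by rewrite ler_wpM2l.
have h2 : 0 <= (lam + e) * r%:R by rewrite mulr_ge0.
rewrite natrD natrM mulrDr.
have -> : (lam + e) * (q%:R * N%:R) = q%:R * ((lam + e) * N%:R) by ring.
by lra.
Qed.

Lemma nbhs_EFin_dist (R : realType) (y : R) (B : set (\bar R)) : nbhs y%:E B ->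
  exists2 e : R, 0 < e & forall t, `|t - y| < e -> B t%:E.
Proof.
move=> /= hB; have : nbhs y [set r | B r%:E] by [].
move=> /nbhs_ballP[e /= e0 he]; exists e => // t ht; apply: he.
by rewrite /ball /= distrC.
Qed.

(** Boundedness makes the upper limit a real number, and h then comes close to it on every set of
    the filter. Only this property is used for density, so that limits, upper limits and lower
    limits can be treated alike. *)
Lemma limf_esup_freq (R : realType) (F : set_system R) (h : R -> R) (l u : R) :
  ProperFilter F -> F [set x | l <= h x <= u] ->
  exists2 y : R, limf_esup (fun x => (h x)%:E) F = y%:E &
    forall e, 0 < e -> forall V, F V -> exists2 x, V x & `|h x - y| < e.
Proof.
move=> PF F0; set f := fun x => (h x)%:E.
have Usup V : F V -> (limf_esup f F <= ereal_sup (f @` V))%E.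
  by move=> FV; apply: ereal_inf_lbound; exists V.
have Uu : (limf_esup f F <= u%:E)%E.
  apply: le_trans (Usup _ F0) _; apply: ge_ereal_sup => _ [x /andP[_ xu] <-].
  by rewrite lee_fin.
have Ul : (l%:E <= limf_esup f F)%E.
  apply: le_ereal_inf_tmp => _ [V FV <-].
  have [x [Vx /andP[lx _]]] := filter_ex (filterI FV F0).
  by apply: le_trans (ereal_sup_ubound (ex_intro2 _ _ x Vx erefl)); rewrite lee_fin.
have Ufin : limf_esup f F \is a fin_num.
  by rewrite fin_numE -ltNye -ltey (lt_le_trans _ Ul) ?ltNyr// (le_lt_trans Uu) ?ltry.
exists (fine (limf_esup f F)); first by rewrite fineK.
move=> e e0 V FV; set y := fine _; have Uy : limf_esup f F = y%:E by rewrite fineK.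
have : (limf_esup f F < (y + e)%:E)%E by rewrite Uy lte_fin ltrDl.
case/ereal_inf_lt => _ [V1 FV1 <-] hV1.
(* On V1 the function stays below y + e, while its supremum on the smaller set V [&] V1 is still at
   least y. *)
have : ((y - e)%:E < ereal_sup (f @` (V `&` V1)))%E.
  apply: lt_le_trans (Usup _ (filterI FV FV1)); rewrite Uy lte_fin.
  by rewrite ltrBlDr ltrDl.
case/ereal_sup_gt => _ [x [Vx V1x] <-]; rewrite lte_fin => h1; exists x => //.
have : (f x < (y + e)%:E)%E.
  by apply: le_lt_trans hV1; apply: ereal_sup_ubound; exists x.
by rewrite lte_fin => h2; rewrite ltr_distl h1.
Qed.

Lemma limf_einf_freq (R : realType) (F : set_system R) (h : R -> R) (l u : R) :
  ProperFilter F -> F [set x | l <= h x <= u] ->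
  exists2 y : R, limf_einf (fun x => (h x)%:E) F = y%:E &
    forall e, 0 < e -> forall V, F V -> exists2 x, V x & `|h x - y| < e.
Proof.
move=> PF F0; have [|y ey hy] := @limf_esup_freq R F (fun x => - h x) (- u) (- l) PF.
  by apply: filterS F0 => x /andP[h1 h2] /=; rewrite !lerN2 h1 h2.
exists (- y); first by rewrite /limf_einf EFinN -ey.
move=> e e0 V FV; have [x Vx hx] := hy e e0 V FV; exists x => //.
by rewrite -normrN opprB addrC.
Qed.

Lemma cvg_freq_unique (R : realType) (F : set_system R) (h : R -> R) (y : R) z :
  ProperFilter F -> (fun x => (h x)%:E) @ F --> z ->
  (forall e, 0 < e -> forall V, F V -> exists2 x, V x & `|h x - y| < e) ->
  z = y%:E.
Proof.
move=> PF hz hy; apply: ereal_hausdorff => A B zA /nbhs_EFin_dist[e e0 he].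
have [x Ax /he Bx] := hy e e0 _ (hz _ zA).
by exists (h x)%:E.
Qed.

Lemma limf_cvg (R : realType) (F : set_system R) (h : R -> R) (y : R) :
  ProperFilter F -> (fun x => (h x)%:E) @ F --> y%:E ->
  limf_esup (fun x => (h x)%:E) F = y%:E /\ limf_einf (fun x => (h x)%:E) F = y%:E.
Proof.
move=> PF hy; have F0 : F [set x | y - 1 <= h x <= y + 1].
  have : nbhs y%:E [set t : \bar R | ((y - 1)%:E <= t <= (y + 1)%:E)%E].
    have : nbhs y [set r | y - 1 <= r <= y + 1].
      apply/nbhs_ballP; exists 1 => //= r; rewrite /ball /= ltr_distl => h1.
      by apply/andP; split; lra.
    by apply: filterS => r /=; rewrite !lee_fin.
  move=> /hy; rewrite nbhs_simpl /= => h1.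
  by apply: (@filterS _ F _ _ _ _ h1) => x /=; rewrite !lee_fin.
have [z ez hz] := limf_esup_freq PF F0; have [z' ez' hz'] := limf_einf_freq PF F0.
have [e1] := cvg_freq_unique PF hy hz; have [e2] := cvg_freq_unique PF hy hz'.
by rewrite ez ez' -e1 -e2.
Qed.

(** * Growth rate of the covering weight along a cycle *)

Section CycleRate.
Context {R : realType} {m : nat}.
Variables (rho : R) (d p : 'I_m.+1 -> R).
Hypothesis H : unit_ifs rho d p.

Local Notation net_chain := (net_chain rho d).
Local Notation is_child := (is_child rho d).
Local Notation nrm := (nrm rho d p).
Local Notation cover_wt := (cover_wt rho d p).
Local Notation p0 := (p ord0).

Let p0_gt0 : 0 < p0. Proof. exact: ui_p0 H _. Qed.

Lemma lnX_nat (x : R) n : 0 < x -> ln (x ^+ n) = n%:R * ln x.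
Proof. by move=> x0; rewrite lnXn// mulr_natl. Qed.

Lemma ln_p0_le0 : ln p0 <= 0.
Proof.
apply: ln_le0; rewrite -(ui_p1 H) (bigD1 ord0)//= lerDl.
by apply: sumr_ge0 => l _; apply/ltW/(ui_p0 H).
Qed.

Lemma cover_wt_chain Ds g n k : net_chain Ds g ->
  p0 ^+ k * cover_wt n (Ds n) <= cover_wt (n + k) (Ds (n + k)%N) <= cover_wt n (Ds n).
Proof.
move=> ch; elim: k => [|k /andP[h1 h2]]; first by rewrite addn0 mul1r lexx.
have [/(cover_wt_parent H)/andP[h3 h4] _] := ch (n + k)%N.
rewrite addnS exprS -mulrA (le_trans h4)// andbT; apply: le_trans h3.
by rewrite ler_pM2l.
Qed.

Lemma ln_cover_wt_chain Ds g n k : net_chain Ds g ->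
  k%:R * ln p0 + ln (cover_wt n (Ds n)) <= ln (cover_wt (n + k) (Ds (n + k)%N))
    <= ln (cover_wt n (Ds n)).
Proof.
move=> ch; have /andP[h1 h2] := cover_wt_chain n k ch.
have q n' : 0 < cover_wt n' (Ds n') by apply: (cover_wt_gt0 H); apply: net_chain_net ch.
by rewrite -lnX_nat// -lnM ?posrE ?exprn_gt0// !ler_ln ?posrE ?mulr_gt0 ?exprn_gt0// h1.
Qed.

Lemma ln_cover_wt_bound Ds g n : net_chain Ds g ->
  n%:R * ln p0 <= ln (cover_wt n (Ds n)) <= 0.
Proof.
move=> ch; have := ln_cover_wt_chain 0 n ch; rewrite add0n.
have : ln (cover_wt 0 (Ds 0%N)) = 0.
  apply/eqP; rewrite ln_eq0 ?(cover_wt_gt0 H)//; last by apply: net_chain_net ch.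
  rewrite (net0_mem (net_chain_net 0 ch)) /cover_wt /wt (big_pred1 [tuple]) /pw ?big_nil//.
  by move=> w; rewrite tuple0 /= /sub_itv /= !lexx eqxx.
by move=> ->; rewrite addr0.
Qed.

Lemma ln_cover_wt_nrm Ds g n : net_chain Ds g -> exists2 K, 0 <= K & forall k,
  `|ln (cover_wt (n + k) (Ds (n + k)%N)) -
    (k%:R * ln p0 + ln (nrm (g n) (seg g n k)))| <= K.
Proof.
move=> ch; have [c c0 hc] := cover_wt_nrm H n ch.
exists `|ln c| => // k; have /andP[h1 h2] := hc k.
have Q0 : 0 < cover_wt (n + k) (Ds (n + k)%N).
  by apply: (cover_wt_gt0 H); apply: net_chain_net ch.
have pk : 0 < p0 ^+ k by apply: exprn_gt0.
have N0 : 0 < nrm (g n) (seg g n k) by rewrite -(pmulr_rgt0 _ pk) (lt_le_trans Q0).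
move: h1 h2; rewrite -ler_ln ?posrE ?mulr_gt0// => h1.
rewrite -ler_ln ?posrE ?mulr_gt0// => h2; move: h1 h2.
rewrite !lnM ?posrE ?mulr_gt0// lnX_nat// => h1 h2.
by rewrite ler0_norm; [have := ler_norm (- ln c); rewrite normrN|]; lra.
Qed.

(** Let f k be the logarithm of the norm of k turns of the cycle. Submultiplicativity makes f
    subadditive, and since the positive block t separates the copies of s1, each turn adds at least
    ln (nrm s1). Fekete's lemma gives a rate lam per turn, trapped between the logarithms of the
    norms of s1 and of s; tau is the resulting rate of ln Q_n per level. *)
Lemma cycle_rate Ds g J s1 t : let s := s1 ++ t in net_chain Ds g ->
  s <> [::] -> last (g J) s = g J -> path is_child (g J) s ->
  all_ge1 rho d p (last (g J) s1) t ->
  (forall k, seg g J (k * size s) = flatten (nseq k s)) ->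
  exists lam, [/\ 0 <= ln (nrm (g J) s1), ln (nrm (g J) s1) <= lam, lam <= ln (nrm (g J) s) &
    let tau := ln p0 + lam / (size s)%:R in
    forall e, 0 < e -> exists K, forall n, (J <= n)%N ->
      `|ln (cover_wt n (Ds n)) - n%:R * tau| <= e * n%:R + K].
Proof.
move=> s ch s0 ls ps pos hseg; set a := g J in ls ps pos *.
have L0 : (0 < size s)%N by case: (s) s0.
have a0 : (0 < size (nb a))%N.
  have := cover_wt_gt0 H (net_chain_net J ch); have [_ e] := ch J.
  rewrite (cover_wt_sum H (esym e)) -/a; case: (size _) => //.
  by rewrite big_ord0 ltxx.
have lk k : last a (flatten (nseq k s)) = a by elim: k => //= k IH; rewrite last_cat ls.
have pk k : path is_child a (flatten (nseq k s)).
  by elim: k => //= k IH; rewrite cat_path ps ls.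
have n1 u : path is_child a u -> 1 <= nrm a u by move=> pu; apply: (nrm_ge1 H).
have n0 u : path is_child a u -> 0 < nrm a u by move=> /n1; apply: lt_le_trans.
have ps1 : path is_child a s1 by move: ps; rewrite cat_path => /andP[].
pose f k := ln (nrm a (flatten (nseq k s))).
have A0 : 0 <= ln (nrm a s1) by apply/ln_ge0/n1.
have fD k l : f (k + l)%N <= f k + f l.
  have f0 k' : 0 < nrm a (flatten (nseq k' s)) by apply: n0.
  rewrite /f -lnM ?posrE// ler_ln ?posrE ?mulr_gt0// nseqD flatten_cat.
  by apply: le_trans (nrm_cat_le H _ _ _) _; rewrite lk.
have fA k : ln (nrm a s1) * k%:R <= f k.
  elim: k => [|k IH]; first by rewrite mulr0; apply/ln_ge0/n1.
  rewrite -natr1 mulrDr mulr1; apply: (@le_trans _ _ (f k + ln (nrm a s1))).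
    by rewrite lerD2r.
  have g1 : 0 < nrm a s1 by apply: n0.
  have g2 : 0 < nrm a (flatten (nseq k s)) by apply: n0.
  have g3 : 0 < nrm a (flatten (nseq k.+1 s)) by apply: n0.
  rewrite /f addrC -lnM ?posrE// ler_ln ?posrE ?mulr_gt0//=.
  have := nrm_cat_ge H (flatten (nseq k s)) pos.
  by rewrite -last_cat -/s ls catA.
have [lam [h1 h2 h3 h4]] := subadditive_rate fD A0 fA.
exists lam; split => //; first by rewrite /f /= cats0 in h2.
move=> tau e e0; have [K hK] := h4 e e0.
have [K2 K20 hK2] := ln_cover_wt_nrm J ch.
(* The terms account, in order, for the incomplete last turn, for replacing Q_n by the norm, for
   Fekete's lemma, and for the J + r levels outside the complete turns. *)
exists ((size s)%:R * - ln p0 + K2 + `|K| + (J + size s)%:R * `|tau|) => n Jn.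
have lp := ln_p0_le0.
set L := size s; set k := ((n - J) %/ L)%N; set r := ((n - J) %% L)%N.
have rL : (r < L)%N by apply: ltn_pmod.
have nE : n = (J + k * L + r)%N by rewrite -addnA -divn_eq subnKC.
have /andP[q1 q2] := ln_cover_wt_chain (J + k * L) r ch; rewrite -nE in q1 q2.
have := hK2 (k * L)%N; rewrite hseg -/(f k) ler_norml => /andP[q3 q4].
have q5 := hK k; have q6 := h3 k.
have tauE : lam * k%:R = (k * L)%:R * (tau - ln p0).
  have LR : L%:R != 0 :> R by rewrite pnatr_eq0 -lt0n.
  by rewrite /tau natrM addrC addKr -/L; field.
have q7 : e * k%:R <= e * n%:R.
  rewrite ler_pM2l// ler_nat nE -addnA (leq_trans _ (leq_addl _ _))//.
  by rewrite (leq_trans _ (leq_addr _ _))// leq_pmulr.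
have q8 : r%:R * - ln p0 <= L%:R * - ln p0 by rewrite ler_wpM2r ?oppr_ge0// ler_nat ltnW.
have q9 : `|(J + r)%:R * tau| <= (J + L)%:R * `|tau|.
  by rewrite normrM ger0_norm// ler_wpM2r// ler_nat leq_add2l ltnW.
move: q9; rewrite ler_norml => /andP[q9 q10].
have := ler_norm K; have nK := normr_ge0 K.
have -> : n%:R * tau = (k * L)%:R * tau + (J + r)%:R * tau.
  by rewrite -mulrDl -natrD nE; congr (_%:R * _); rewrite addnCA addnA.
rewrite tauE mulrBr in q6.
rewrite mulrDl {1}tauE mulrBr in q5.
rewrite ler_norml => q11; apply/andP; split; lra.
Qed.

End CycleRate.

(** * The self-similar measure *)

Section Mass.
Context {R : realType} {m : nat}.
Variables (rho : R) (d p : 'I_m.+1 -> R).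
Variable mu : probability (measurableTypeR R) R.
Hypothesis rho01 : 0 < rho < 1.
Hypothesis d_lt : {homo d : i j / (i < j)%N >-> i < j}.
Hypothesis p_gt0 : forall j, 0 < p j.
Hypothesis p_sum : \sum_j p j = 1.
Hypothesis ss : self_similar rho d p mu.

Local Notation word n := (n.-tuple 'I_m.+1).
Local Notation S := (S_word rho d).
Local Notation mes A := (measurable (A : set (measurableTypeR R))).

Let rho0 : 0 < rho. Proof. by have /andP[] := rho01. Qed.
Let rho1 : rho < 1. Proof. by have /andP[] := rho01. Qed.

Definition mass (A : set R) : R := fine (mu A).

Lemma mass_ge0 A : 0 <= mass A.
Proof. exact: fine_ge0. Qed.

Lemma massE A : mes A -> mu A = (mass A)%:E.
Proof. by move=> mA; rewrite /mass fineK// fin_num_measure. Qed.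

Lemma le_mass A B : mes A -> mes B -> A `<=` B -> mass A <= mass B.
Proof.
by move=> mA mB AB; rewrite -lee_fin -!massE//; apply: le_measure; rewrite ?inE.
Qed.

Lemma mass_le1 A : mes A -> mass A <= 1.
Proof. by move=> mA; rewrite -lee_fin -massE//; apply: probability_le1. Qed.

Lemma mes_S_word w A : mes A -> mes (S w @^-1` A).
Proof.
move=> mA; rewrite -[X in measurable X]setTI.
have : measurable_fun [set: measurableTypeR R] (fun x : R => rho ^+ size w * x + S w 0).
  apply: continuous_measurable_fun => x; apply: cvgD; last exact: cvg_cst.
  by apply: cvgM; [exact: cvg_cst|exact: cvg_id].
rewrite (_ : (fun x : R => _) = S w); last by apply/funext => x; rewrite -S_wordE.
by move/(_ measurableT A mA).
Qed.

Lemma mass_sim A : mes A -> mass A = \sum_(j < m.+1) p j * mass (sim rho d j @^-1` A).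
Proof.
move=> mA; apply: EFin_inj; rewrite -massE// (ss mA) -sumEFin.
by apply: eq_bigr => j _; rewrite EFinM -massE//; apply: (@mes_S_word [:: j]).
Qed.

Lemma mass_word n A : mes A ->
  mass A = \sum_(w : word n) pw p w * mass (S w @^-1` A).
Proof.
move=> mA; elim: n => [|n IH].
  rewrite (big_pred1 [tuple]) /pw ?big_nil ?mul1r// => w.
  by rewrite (tuple0 w) /= eqxx.
rewrite IH (big_tuple_rcons _ n xpredT (fun w => pw p w * mass (S w @^-1` A))).
apply: eq_bigr => w _; rewrite (mass_sim (mes_S_word w mA)) mulr_sumr.
apply: eq_bigr => l _; rewrite pw_rcons mulrA; congr (_ * mass _).
by apply/seteqP; split=> x /=; rewrite S_rcons.
Qed.

Definition hull s : set R := [set` `[d ord0 / (1 - rho) - s, d ord_max / (1 - rho) + s]].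

Lemma mem_hull s x : hull s x <->
  d ord0 - s * (1 - rho) <= x * (1 - rho) <= d ord_max + s * (1 - rho).
Proof.
have r1 : 0 < 1 - rho by rewrite subr_gt0.
rewrite /hull /= in_itv /= -(ler_pM2r r1) -[X in _ && X](ler_pM2r r1).
by rewrite mulrBl mulrDl !divfK ?gt_eqF.
Qed.

(* The hull is mapped into itself by the similarities, which contract the
   distance to it; hence the complement of any neighbourhood is null. *)
Lemma mass_hull s : 0 < s -> mass (hull s) = 1.
Proof.
move=> s0; apply/eqP; rewrite eq_le mass_le1 ?andTb; last exact: measurable_itv.
have step t : 0 < t -> mass (hull (t / rho)) <= mass (hull t).
  move=> t0; rewrite [leRHS]mass_sim; last exact: measurable_itv.
  rewrite -[leLHS]mul1r -p_sum mulr_suml; apply: ler_sum => j _.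
  rewrite ler_pM2l//; apply: le_mass; first exact: measurable_itv.
    by apply: (@mes_S_word [:: j]); exact: measurable_itv.
  move=> x /mem_hull/andP[h1 h2]; apply/mem_hull; rewrite /sim.
  have d1 : d ord0 <= d j by apply: (ord_homo_le d_lt).
  have d2 : d j <= d ord_max by apply: (ord_homo_le d_lt); rewrite -ltnS ltn_ord.
  have e1 : rho * (d ord0 - t / rho * (1 - rho)) = rho * d ord0 - t * (1 - rho).
    by field; rewrite gt_eqF.
  have e2 : rho * (d ord_max + t / rho * (1 - rho)) = rho * d ord_max + t * (1 - rho).
    by field; rewrite gt_eqF.
  have h3 : rho * d ord0 - t * (1 - rho) <= rho * (x * (1 - rho)).
    by rewrite -e1 ler_pM2l.
  have h4 : rho * (x * (1 - rho)) <= rho * d ord_max + t * (1 - rho).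
    by rewrite -e2 ler_pM2l.
  have h5 : d ord0 * (1 - rho) <= d j * (1 - rho) by rewrite ler_pM2r// subr_gt0.
  have h6 : d j * (1 - rho) <= d ord_max * (1 - rho) by rewrite ler_pM2r// subr_gt0.
  by apply/andP; split; lra.
pose F k := hull (s / rho ^+ k).
have Fle k : mass (F k) <= mass (hull s).
  elim: k => [|k IH]; first by rewrite /F expr0 divr1.
  apply: le_trans IH; rewrite /F exprSr invfM mulrA; apply: step.
  by rewrite divr_gt0// exprn_gt0.
(* The hulls F k increase to the whole line, so 1 is the limit of masses that are all at most that
   of [hull s]. *)
have FU : \bigcup_k F k = setT.
  apply/seteqP; split => // x _.
  pose M := `|x| + `|d ord0 / (1 - rho)| + `|d ord_max / (1 - rho)|.
  have [k hk] : exists k, M * rho ^+ k <= s.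
    have : (fun k => M * rho ^+ k) @ \oo --> M * 0.
      by apply: cvgMr; apply: cvg_expr; rewrite ger0_norm ?ltW.
    rewrite mulr0 => /cvgrPdist_le /(_ s s0) [k _ hk]; exists k.
    by have := hk k (leqnn k); rewrite sub0r normrN; apply: le_trans; exact: ler_norm.
  exists k => //; rewrite /F /hull /= in_itv /=.
  have : M <= s / rho ^+ k by rewrite ler_pdivlMr// exprn_gt0.
  rewrite /M; move: (d ord0 / _) (d ord_max / _) => A B hM.
  have := ler_norm x; have := ler_norm (- x); have := ler_norm A.
  have := ler_norm (- A); have := ler_norm B; have := ler_norm (- B).
  rewrite !normrN => ? ? ? ? ? ?.
  have := normr_ge0 A; have := normr_ge0 B => ? ?.
  by apply/andP; split; lra.
have : (mu \o F) @ \oo --> mu (\bigcup_k F k).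
  apply: nondecreasing_cvg_mu.
  - by move=> k; exact: measurable_itv.
  - by rewrite FU; exact: measurableT.
  - apply/nondecreasing_seqP => k; rewrite subsetEset => x.
    rewrite /F /hull /= !in_itv /= => /andP[h1 h2].
    have h : s / rho ^+ k <= s / rho ^+ k.+1.
      rewrite ler_pM2l// lef_pV2 ?posrE ?exprn_gt0// exprS.
      by rewrite ger_pMl ?exprn_gt0// ltW.
    by apply/andP; split; lra.
rewrite FU probability_setT => cv.
have : (1%:E <= (mass (hull s))%:E)%E; last by rewrite lee_fin.
apply: (cvge_le _ cv); apply: nearW => k /=.
by rewrite massE ?lee_fin; [exact: Fle|exact: measurable_itv].
Qed.

Lemma mass_full A s : 0 < s -> mes A -> hull s `<=` A -> mass A = 1.
Proof.
move=> s0 mA hA; apply/eqP; rewrite eq_le mass_le1//= -(mass_hull s0).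
by apply: le_mass => //; exact: measurable_itv.
Qed.

Lemma mass_null A s : 0 < s -> mes A -> (forall x, A x -> ~ hull s x) -> mass A = 0.
Proof.
move=> s0 mA hA; have mC : mes (~` A) by exact: measurableC.
have C1 : mass (~` A) = 1 by apply: (mass_full s0) => // x hx Ax; exact: (hA x Ax hx).
have := probability_setC mu mA; rewrite (massE mC) (massE mA) C1 -EFinB => e.
have := EFin_inj e; lra.
Qed.

Lemma msupport_hull x : msupport mu x ->
  d ord0 / (1 - rho) <= x <= d ord_max / (1 - rho).
Proof.
move=> sx; apply/andP; split; rewrite leNgt; apply/negP => lt.
- set A := d ord0 / _ in lt; have mU : mes `]-oo, ((x + A) / 2)[%classic.
    exact: measurable_itv.
  have := sx `]-oo, ((x + A) / 2)[%classic (interval_open _ _).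
  rewrite massE// (@mass_null _ ((A - x) / 4)) ?ltxx//; last first.
    move=> y; rewrite /hull /= !in_itv /= -/A => yl /andP[]; lra.
    by rewrite divr_gt0// subr_gt0.
  by rewrite /= in_itv /=; lra.
- set A := d ord_max / _ in lt; have mU : mes `]((x + A) / 2), +oo[%classic.
    exact: measurable_itv.
  have := sx `]((x + A) / 2), +oo[%classic (interval_open _ _).
  rewrite massE// (@mass_null _ ((x - A) / 4)) ?ltxx//; last first.
    move=> y; rewrite /hull /= !in_itv /= -/A andbT => yl /andP[]; lra.
    by rewrite divr_gt0// subr_gt0.
  by rewrite /= in_itv /= andbT; lra.
Qed.

(** The similarity of the constant word j ^ n maps a neighbourhood of the hull, of full mass, into
    any given neighbourhood of the fixed point once n is large, and that word has positive
    weight. *)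
Lemma msupport_fixpoint j : msupport mu (d j / (1 - rho)).
Proof.
move=> U oU Uc; set c := d j / (1 - rho) in Uc.
have mU : mes U by exact: open_measurable.
rewrite massE// lte_fin.
have /nbhs_ballP[e /= e0 he] : nbhs c U by apply: open_nbhs_nbhs.
have Sc n x : S (nseq n j) x = c + rho ^+ n * (x - c).
  elim: n => [|n IH] /=; first by rewrite mul1r subrKC.
  rewrite /sim IH exprS /c; field; by rewrite gt_eqF// subr_gt0.
pose M := `|d ord0 / (1 - rho)| + `|d ord_max / (1 - rho)| + 1 + `|c|.
have [n hn] : exists n, M * rho ^+ n < e.
  have : (fun k => M * rho ^+ k) @ \oo --> M * 0.
    by apply: cvgMr; apply: cvg_expr; rewrite ger0_norm ?ltW.
  rewrite mulr0 => /cvgrPdist_lt /(_ e e0) [k _ hk]; exists k.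
  by have := hk k (leqnn k); rewrite sub0r normrN; apply: le_lt_trans; exact: ler_norm.
rewrite (mass_word n mU) (bigD1 [tuple of nseq n j])//= ltr_wpDr//.
  by apply: sumr_ge0 => w _; rewrite mulr_ge0 ?mass_ge0// prodr_ge0// => l _; exact: ltW.
rewrite mulr_gt0 ?prodr_gt0// (@mass_full _ 1) ?ltr01//; first exact: mes_S_word.
move=> x hx /=; apply: he; rewrite /ball /= Sc opprD addNKr normrN normrM.
rewrite ger0_norm ?exprn_ge0 ?(ltW rho0)// mulrC; apply: le_lt_trans hn.
rewrite ler_wpM2r ?exprn_ge0 ?(ltW rho0)//; move: hx; rewrite /hull /= in_itv /= /M.
move: (d ord0 / _) (d ord_max / _) => A B /andP[h1 h2].
apply: le_trans (ler_normB _ _) _; rewrite lerD2r ler_norml.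
have := ler_norm A; have := ler_norm (- A); have := ler_norm B; have := ler_norm (- B).
rewrite !normrN; have := normr_ge0 A; have := normr_ge0 B => ? ? ? ? ? ?.
by apply/andP; split; lra.
Qed.

End Mass.

(** The extreme fixed points belong to the support and the support lies between them, so they are 0
    and 1. A gap larger than rho between consecutive d_i would leave a null open interval inside
    [0, 1]. *)
Lemma standard_unit_ifs (R : realType) (m : nat) (rho : R) (d p : 'I_m.+1 -> R)
    (mu : probability (measurableTypeR R) R) :
  standard_assumptions rho d p mu -> unit_ifs rho d p.
Proof.
case=> m0 rho01 dlt p0 psum ss ft pends pmin supp.
have /andP[rho0 rho1] := rho01; have r1 : 0 < 1 - rho by rewrite subr_gt0.
have inS x : msupport mu x <-> 0 <= x <= 1 by rewrite supp /= in_itv.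
have [f01 f02] : 0 <= d ord0 /\ d ord_max <= 1 - rho.
  have fixS j : msupport mu (d j / (1 - rho)).
    exact: (msupport_fixpoint rho01 dlt p0 psum ss).
  have /inS/andP[h1 _] := fixS ord0; have /inS/andP[_ h2] := fixS ord_max.
  by rewrite pmulr_lge0 ?invr_gt0// in h1; rewrite ler_pdivrMr// mul1r in h2.
have [f11 f12] : d ord0 <= 0 /\ 1 - rho <= d ord_max.
  have /inS/(msupport_hull rho01 dlt p0 psum ss)/andP[h1 _] : 0 <= (0 : R) <= 1.
    by rewrite lexx ler01.
  have /inS/(msupport_hull rho01 dlt p0 psum ss)/andP[_ h2] : 0 <= (1 : R) <= 1.
    by rewrite lexx ler01.
  by rewrite ler_pdivrMr// mul0r in h1; rewrite ler_pdivlMr// mul1r in h2.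
have d0 : d ord0 = 0 by lra.
have dm : d ord_max = 1 - rho by lra.
split => // i j ij; rewrite leNgt; apply/negP => gap.
have dle := ord_homo_le dlt.
have di0 : 0 <= d i by rewrite -d0; apply: dle.
have dj1 : d j <= 1 - rho by rewrite -dm; apply: dle; rewrite -ltnS ltn_ord.
(* The excess gap has width 4 s and U is its middle half. Letters up to i map the s-neighbourhood of
   [0, 1] below U, and letters from j on map it above U. *)
pose s := (d j - (rho + d i)) / 4.
have s0 : 0 < s by rewrite divr_gt0// subr_gt0.
pose U := `](rho + d i + s), (d j - s)[%classic.
have mU : measurable (U : set (measurableTypeR R)) by exact: measurable_itv.
have /inS/(_ U (interval_open _ _)) : 0 <= rho + d i + 2 * s <= 1.
  by rewrite /s; apply/andP; split; lra.
rewrite massE// lte_fin (mass_sim ss mU) big1 ?ltxx//.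
  by move=> h; apply: notF; apply: h; rewrite /U //= in_itv /= /s; apply/andP; split; lra.
move=> l _; rewrite (mass_null rho01 dlt p0 psum ss s0) ?mulr0//.
  exact: (@mes_S_word _ _ rho d [:: l]).
move=> x; rewrite /U /hull /sim /= !in_itv /= d0 dm mul0r divff ?gt_eqF// => /andP[x1 x2].
move=> /andP[x3 x4].
have rs : rho * s <= s by rewrite ger_pMl// ltW.
have [li|il] := leqP l i.
  have := dle _ _ li => dli; have : rho * x <= rho * (1 + s) by rewrite ler_pM2l.
  by lra.
have := dle j l; rewrite ij => /(_ il) djl.
have : rho * (0 - s) <= rho * x by rewrite ler_pM2l.
by lra.
Qed.

(** * Balls and local dimensions *)

(** Meant for b = ln mu(ball), q = ln Q_n, t = - ln r, l = - ln rho and P = ln p_0. The denominators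
    t and n l differ by at most l, and |q| / (n l) <= - P / l, so exchanging them costs at most - P
    in the numerator. *)
Lemma ratio_close (R : realFieldType) (b q t l n e K P : R) :
  0 < n -> 0 < l -> n * l < t -> t <= n * l + l -> n * P <= q -> q <= 0 ->
  `|b - q| <= e * l / 2 * n + K -> K - P <= e * l / 2 * n ->
  `|b / - t - q / (n * - l)| <= e.
Proof.
move=> n0 l0 lt lt' q1 q2 hb nK.
have nl0 : 0 < n * l by rewrite mulr_gt0.
have t0 : 0 < t by rewrite (lt_trans _ lt).
pose c := q / (n * l).
have qE : q = c * (n * l) by rewrite divfK// gt_eqF.
have c0 : c <= 0 by rewrite pmulr_lle0 ?invr_gt0.
have cl : P <= c * l by rewrite -(ler_pM2l n0) mulrCA -qE.
have -> : b / - t - q / (n * - l) = (c * t - b) / t.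
  by rewrite /c; field; rewrite ?gt_eqF.
rewrite normrM [X in _ * X]ger0_norm ?invr_ge0 ?(ltW t0)// ler_pdivrMr//.
have h1 : c * (t - n * l) <= 0 by rewrite mulr_le0_ge0// subr_ge0 ltW.
have h2 : c * l <= c * (t - n * l) by rewrite ler_wnM2l// lerBlDl.
have e0 : 0 <= e * l * n.
  by have := normr_ge0 (b - q); have := normr_ge0 (b - q); move: hb nK; lra.
have et : e * (n * l) <= e * t.
  rewrite ler_wpM2l ?(ltW lt)//; move: e0.
  by rewrite pmulr_lge0// pmulr_lge0.
rewrite mulrBr -qE in h1 h2.
have eE : e * (n * l) = e * l / 2 * n + e * l / 2 * n by field.
rewrite eE in et.
move: hb; rewrite !ler_norml => /andP[h3 h4].
by apply/andP; split; lra.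
Qed.

Section Balls.
Context {R : realType} {m : nat}.
Variables (rho : R) (d p : 'I_m.+1 -> R).
Variable mu : probability (measurableTypeR R) R.
Hypothesis Hmu : standard_assumptions rho d p mu.

Local Notation word n := (n.-tuple 'I_m.+1).
Local Notation S := (S_word rho d).
Local Notation net := (net rho d).
Local Notation net_chain := (net_chain rho d).
Local Notation cover_wt := (cover_wt rho d p).
Local Notation p0 := (p ord0).
Local Notation ball_mass x r := (mass mu [set` `[x - r, x + r]]).

Let H : unit_ifs rho d p. Proof. exact: standard_unit_ifs Hmu. Qed.
Let rho0 : 0 < rho. Proof. by have /andP[] := ui_rho H. Qed.
Let rho1 : rho < 1. Proof. by have /andP[] := ui_rho H. Qed.
Let rn0 n : 0 < rho ^+ n. Proof. exact: exprn_gt0. Qed.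
Let p0_gt0 : 0 < p0. Proof. exact: ui_p0 H _. Qed.

Lemma hull01 s y : hull rho d s y <-> - s <= y <= 1 + s.
Proof.
rewrite /hull /= in_itv /= (ui_d0 H) (ui_dm H) mul0r divff ?sub0r//.
by rewrite gt_eqF// subr_gt0.
Qed.

Lemma ball_mass_ge n D x r : D \in net n -> D.1 <= x <= D.2 -> rho ^+ n < r ->
  cover_wt n D <= ball_mass x r.
Proof.
move=> Dn /andP[Dx xD] nr; case: (Hmu) => _ rho01 dlt pgt psum ss _ _ _ _.
rewrite (mass_word ss n); last exact: measurable_itv.
rewrite /cover_wt wt_mkcond; apply: ler_sum => w _.
rewrite ler_pM2l ?(pw_gt0 H)//.
have [/andP[/= h1 h2]|_] := boolP (sub_itv _ _); last exact: mass_ge0.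
(* Full mass is known only for neighbourhoods of [0, 1]; the strict inequality rho ^ n < r leaves
   room for one of width s. *)
pose s := (r - rho ^+ n) / rho ^+ n.
have s0 : 0 < s by rewrite divr_gt0// subr_gt0.
rewrite (mass_full rho01 dlt pgt psum ss s0)//.
  by apply: (mes_S_word rho d w); exact: measurable_itv.
move=> y /hull01 /andP[y0 y1]; rewrite /= in_itv /= S_wordE size_tuple.
rewrite S_word1 size_tuple in h2.
have e : rho ^+ n * s = r - rho ^+ n by rewrite /s mulrC divfK ?gt_eqF.
have : rho ^+ n * - s <= rho ^+ n * y by rewrite ler_pM2l.
have : rho ^+ n * y <= rho ^+ n * (1 + s) by rewrite ler_pM2l.
by rewrite mulrN mulrDr mulr1 e => ? ?; apply/andP; split; lra.
Qed.

(** By [endpoint_spacing], an interval S_w [0, 1] that neither covers D nor abuts it is at distance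
    at least eps rho ^ n from D, and such words contribute nothing. Those abutting on the left and
    on the right weigh at most n / p_0 times the covering ones each. *)
Lemma ball_mass_le : exists2 eps : R, 0 < eps & forall n D x r,
  D \in net n -> D.1 <= x <= D.2 -> r < eps * rho ^+ n ->
  ball_mass x r <= (1 + 2 * (n%:R / p0)) * cover_wt n D.
Proof.
have [eps eps0 sp] := endpoint_spacing H; exists eps => // n D x r Dn /andP[Dx xD] nr.
case: (Hmu) => _ rho01 dlt pgt psum ss _ _ _ _.
have /netP[D1 D2 ltD gap] := Dn.
pose B : set R := [set` `[x - r, x + r]].
have mB : measurable (B : set (measurableTypeR R)) by exact: measurable_itv.
pose Pw w := [|| sub_itv D (S w 0, S w 1), S w 1 == D.1 | S w 0 == D.2].
have nullw (w : word n) : ~~ Pw w -> mass mu (S w @^-1` B) = 0.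
  rewrite !negb_or => /and3P[]; rewrite cover_net_left// negb_and -ltNge -leNgt.
  move=> ncov n1 n2.
  pose s := (eps * rho ^+ n - r) / (2 * rho ^+ n).
  have s0 : 0 < s by rewrite divr_gt0 ?subr_gt0// mulr_gt0.
  have e : rho ^+ n * s = (eps * rho ^+ n - r) / 2 by rewrite /s; field; rewrite gt_eqF.
  apply: (mass_null rho01 dlt pgt psum ss s0); first exact: (mes_S_word rho d w mB).
  move=> y; rewrite /B /= in_itv /= S_wordE size_tuple => /andP[y1 y2].
  move=> /hull01/andP[y3 y4].
  have h3 : rho ^+ n * - s <= rho ^+ n * y by rewrite ler_pM2l.
  have h4 : rho ^+ n * y <= rho ^+ n * (1 + s) by rewrite ler_pM2l.
  rewrite mulrN e in h3; rewrite mulrDr mulr1 e in h4.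
  case/orP: ncov => h.
    have {}h : D.2 <= S w 0.
      by case: (gap _ (endpoints_S0 rho d w)) => // h'; move: h; rewrite ltNge h'.
    have := sp n _ _ D2 (endpoints_S0 rho d w).
    by rewrite lt_neqAle eq_sym n2 h => /(_ isT); lra.
  have := sp n _ _ (endpoints_S1 rho d w) D1; rewrite lt_neqAle n1 h => /(_ isT).
  by rewrite S_word1 size_tuple; lra.
apply: (@le_trans _ _ (wt p n Pw)).
  rewrite (mass_word ss n mB) wt_mkcond; apply: ler_sum => w _.
  rewrite ler_pM2l ?(pw_gt0 H)//.
  have [_|/nullw ->//] := boolP (Pw w).
  by apply: mass_le1; exact: (mes_S_word rho d w mB).
apply: le_trans (wt_split H (P1 := fun w => sub_itv D (S w 0, S w 1))
  (P2 := fun w => S w 1 == D.1) (P3 := fun w => S w 0 == D.2) _) _ => //.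
have := left_endpoint_wt H Dn; have := right_endpoint_wt H Dn.
rewrite -/(cover_wt n D); move: (n%:R / p0) => c h1 h2.
rewrite mulrDl mul1r -mulrA; move: h1 h2; lra.
Qed.

Lemma exprn_small e : 0 < e -> exists n, rho ^+ n <= e.
Proof.
move=> e0; have : (fun k => rho ^+ k) @ \oo --> (0 : R).
  by apply: cvg_expr; rewrite ger0_norm ?ltW.
move=> /cvgrPdist_le /(_ e e0) [k _ hk]; exists k.
by have := hk k (leqnn k); rewrite sub0r normrN ger0_norm// ltW.
Qed.

Lemma scale_level N r : 0 < r -> r < rho ^+ N ->
  exists2 n, (N <= n)%N & rho ^+ n.+1 <= r < rho ^+ n.
Proof.
move=> r0 rN; have ex : exists n, rho ^+ n <= r by exact: exprn_small.
case: (ex_minnP ex) => k hk kmin.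
have Nk : (N < k)%N.
  rewrite ltnNge; apply/negP => kN; have : rho ^+ N <= rho ^+ k.
    by rewrite ler_wiXn2l ?ltW.
  by move=> h; have := lt_le_trans rN (le_trans h hk); rewrite ltxx.
exists k.-1; first by rewrite -ltnS prednK// (leq_ltn_trans _ Nk).
rewrite prednK ?(leq_ltn_trans _ Nk)// hk /= ltNge; apply/negP => /kmin.
by rewrite leqNgt prednK ?leqnn// (leq_ltn_trans _ Nk).
Qed.

Lemma ln_affine_le (c e : R) : 0 < c -> 0 < e ->
  exists K, forall n : nat, ln (1 + c * n%:R) <= e * n%:R + K.
Proof.
(* From ln y < y at y = u (1 + c n): the choice u = e / c gives the slope e. *)
move=> c0 e0; pose u := e / c; exists (u - ln u) => n.
have u0 : 0 < u by rewrite divr_gt0.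
have t0 : 0 < 1 + c * n%:R by rewrite ltr_pwDl// mulr_ge0// ltW.
have := ln_sublinear (mulr_gt0 u0 t0); rewrite lnM ?posrE// => /ltW.
have -> : u * (1 + c * n%:R) = u + e * n%:R by rewrite /u; field; rewrite gt_eqF.
by lra.
Qed.

Section Point.
Variables (Ds : nat -> R * R) (g : nat -> charvec R) (x : R).
Hypothesis ch : net_chain Ds g.
Hypothesis xD : forall n, x \in `[(Ds n).1, (Ds n).2].

Let xDs n : (Ds n).1 <= x <= (Ds n).2. Proof. by have := xD n; rewrite in_itv. Qed.
Let Dn n : Ds n \in net n. Proof. exact: net_chain_net ch. Qed.
Let Q0 n : 0 < cover_wt n (Ds n). Proof. exact: (cover_wt_gt0 H (Dn n)). Qed.

Lemma ball_mass_rate e : 0 < e -> exists K, forall n r,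
  rho ^+ n.+1 <= r < rho ^+ n ->
  `|ln (ball_mass x r) - ln (cover_wt n (Ds n))| <= e * n%:R + K.
Proof.
move=> e0; have [eps eps0 up] := ball_mass_le.
have [n0 hn0] := exprn_small eps0.
have c0 : 0 < 2 / p0 by rewrite divr_gt0.
have [K hK] := ln_affine_le c0 e0.
have lp := ln_p0_le0 H.
exists (`|K| + (n0.+2)%:R * - ln p0) => n r /andP[r1 r2].
have K0 := normr_ge0 K; have KK := ler_norm K.
have en : 0 <= e * n%:R by rewrite mulr_ge0// ltW.
have n02 : (n0.+2)%:R = n0%:R + 2 :> R by rewrite -addn2 natrD.
have nn0 : 0 <= n0%:R * - ln p0 by rewrite mulr_ge0 ?oppr_ge0.
(* Two levels down, because [ball_mass_ge] needs a strict inequality and only rho ^ (n + 1) <= r is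
   known. *)
have lo : cover_wt (n + 2) (Ds (n + 2)%N) <= ball_mass x r.
  apply: ball_mass_ge => //; apply: lt_le_trans r1.
  by rewrite addn2 [ltLHS]exprS gtr_pMl.
have B0 := lt_le_trans (Q0 _) lo.
have /andP[q1 _] := ln_cover_wt_chain H n 2 ch.
move: lo; rewrite -ler_ln ?posrE// => lo.
have hi : ln (ball_mass x r) <= ln (cover_wt n (Ds n)) + e * n%:R + `|K| + n0%:R * - ln p0.
  (* For n >= n0, r < rho ^ n <= eps rho ^ (n - n0), so [ball_mass_le] applies n0 levels up, and the
     logarithm of its linear factor is absorbed by e n. For n < n0 the trivial bound 1 on the mass
     is enough. *)
  have [nn|nn] := leqP n0 n; last first.
    have : ln (ball_mass x r) <= 0 by apply/ln_le0/mass_le1; exact: measurable_itv.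
    have /andP[q2 _] := ln_cover_wt_bound H n ch.
    have : n%:R * - ln p0 <= n0%:R * - ln p0 by rewrite ler_wpM2r ?oppr_ge0// ler_nat ltnW.
    by lra.
  have /andP[q2 _] := ln_cover_wt_chain H (n - n0) n0 ch; rewrite subnK// in q2.
  have := up (n - n0)%N (Ds (n - n0)%N) x r (Dn _) (xDs _).
  have -> : r < eps * rho ^+ (n - n0).
    apply: lt_le_trans r2 _; rewrite -{1}(subnKC nn) exprD ler_pM2r//.
  move=> /(_ isT); have -> : 2 * ((n - n0)%:R / p0) = 2 / p0 * (n - n0)%:R by ring.
  have t0 : 0 < 1 + 2 / p0 * (n - n0)%:R by rewrite ltr_pwDl// mulr_ge0// ltW.
  rewrite -ler_ln ?posrE ?mulr_gt0// lnM ?posrE// => h.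
  have := hK (n - n0)%N.
  have : e * (n - n0)%:R <= e * n%:R by rewrite ler_pM2l// ler_nat leq_subr.
  by lra.
rewrite n02 ler_norml; apply/andP; split; lra.
Qed.

Lemma dim_ratio_net e N : 0 < e -> exists2 r0 : R, 0 < r0 & forall r, 0 < r < r0 ->
  exists n, [/\ (N <= n)%N, (0 < n)%N &
    `|dim_ratio mu x r - ln (cover_wt n (Ds n)) / (n%:R * ln rho)| <= e].
Proof.
move=> e0; set l := - ln rho; have l0 : 0 < l by rewrite oppr_gt0 ln_lt0// rho0.
have el0 : 0 < e * l / 2 by rewrite divr_gt0// mulr_gt0.
have [K hK] := ball_mass_rate el0.
pose K' := `|K| - ln p0.
have K'0 : 0 <= K' by rewrite addr_ge0 ?oppr_ge0 ?(ln_p0_le0 H).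
pose N' := (maxn N (maxn 1 (Num.truncn (2 * K' / (e * l))).+1))%N.
exists (rho ^+ N') => // r /andP[r0 rN].
have [n Nn hr] := scale_level r0 rN; exists n.
have n1 : (0 < n)%N by apply: leq_trans Nn; rewrite !leq_max orbT.
split => //; first by apply: leq_trans Nn; rewrite leq_max leqnn.
have nK : K' <= e * l / 2 * n%:R.
  have : 2 * K' / (e * l) <= n%:R.
    apply: le_trans (ltW (truncnS_gt _)) _; rewrite ler_nat; apply: leq_trans Nn.
    by rewrite !leq_max leqnn !orbT.
  rewrite ler_pdivrMr ?mulr_gt0// => h.
  have -> : e * l / 2 * n%:R = n%:R * (e * l) / 2 by field.
  by rewrite ler_pdivlMr// mulrC.
have n0 : 0 < n%:R :> R by rewrite ltr0n.
have := hK n r hr; rewrite /dim_ratio -/(ball_mass x r).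
have /andP[q1 q2] := ln_cover_wt_bound H n ch.
move: (ln (ball_mass x r)) (ln (cover_wt n (Ds n))) q1 q2 => b q q1 q2 hb.
have lr1 : n%:R * l < - ln r.
  by have /andP[_] := hr; rewrite -ltr_ln ?posrE// lnX_nat// /l mulrN ltrN2.
have lr2 : - ln r <= n%:R * l + l.
  have /andP[+ _] := hr; rewrite -ler_ln ?posrE// lnX_nat// => h.
  by rewrite -{2}(mul1r l) -mulrDl natr1 /l mulrN lerN2.
have -> : ln rho = - l by rewrite opprK.
have -> : ln r = - - ln r by rewrite opprK.
apply: (ratio_close n0 l0 lr1 lr2 q1 q2 _ nK).
by apply: le_trans hb _; rewrite lerD2l ler_norm.
Qed.

End Point.

Lemma rate_has_dim Ds g x J tau : net_chain Ds g ->
  (forall n, x \in `[(Ds n).1, (Ds n).2]) ->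
  (forall e, 0 < e -> exists K, forall n, (J <= n)%N ->
     `|ln (cover_wt n (Ds n)) - n%:R * tau| <= e * n%:R + K) ->
  has_dim mu x (tau / ln rho)%:E.
Proof.
move=> ch xD rate; apply: cvg_EFin; first by near=> r.
apply/cvgrPdist_le => e e0.
set l := - ln rho; have l0 : 0 < l by rewrite oppr_gt0 ln_lt0// rho0.
have e2 : 0 < e / 2 by rewrite divr_gt0.
have el4 : 0 < e * l / 4 by rewrite divr_gt0// mulr_gt0.
have [K hK] := rate _ el4.
pose N := maxn J (Num.truncn (4 * `|K| / (e * l))).+1.
have [r0 r00 hr0] := dim_ratio_net ch xD N e2.
near=> r; have [|n [Nn n1 hn]] := hr0 r.
  by apply/andP; split; near: r; [exact: nbhs_right_gt|exact: nbhs_right_lt].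
have n0 : 0 < n%:R :> R by rewrite ltr0n.
have nK : `|K| <= e * l / 4 * n%:R.
  have : 4 * `|K| / (e * l) <= n%:R.
    apply: le_trans (ltW (truncnS_gt _)) _; rewrite ler_nat; apply: leq_trans Nn.
    by rewrite leq_max leqnn orbT.
  rewrite ler_pdivrMr ?mulr_gt0// => h.
  have -> : e * l / 4 * n%:R = n%:R * (e * l) / 4 by field.
  by rewrite ler_pdivlMr// mulrC.
have KK := ler_norm K.
have hKn : `|ln (cover_wt n (Ds n)) - n%:R * tau| <= e / 2 * (n%:R * l).
  apply: le_trans (hK n _) _; first by apply: leq_trans Nn; rewrite leq_max leqnn.
  have -> : e / 2 * (n%:R * l) = e * l / 4 * n%:R + e * l / 4 * n%:R by field.
  by rewrite lerD2l (le_trans KK).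
rewrite distrC /=; set q := ln (cover_wt n (Ds n)) in hn hKn.
have -> : dim_ratio mu x r - tau / ln rho =
    (dim_ratio mu x r - q / (n%:R * ln rho)) + (n%:R * tau - q) / (n%:R * l).
  have -> : ln rho = - l by rewrite opprK.
  by field; rewrite !gt_eqF.
apply: le_trans (ler_normD _ _) _; rewrite [leRHS](splitr e) lerD//.
have nl0 : 0 < n%:R * l by rewrite mulr_gt0.
by rewrite normrM [X in _ * X]ger0_norm ?invr_ge0 ?(ltW nl0)// ler_pdivrMr// distrC.
Unshelve. all: by end_near.
Qed.

(** p_0 ^ n <= Q_n <= 1 confines the ratio at level n to [0, ln p_0 / ln rho]; the margin 1 is the
    precision asked of [dim_ratio_net]. *)
Lemma dim_ratio_bounded Ds g x : net_chain Ds g ->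
  (forall n, x \in `[(Ds n).1, (Ds n).2]) ->
  ((0 : R)^'+) [set r | - 1 <= dim_ratio mu x r <= ln p0 / ln rho + 1].
Proof.
move=> ch xD; have [r0 r00 hr0] := dim_ratio_net ch xD 1 ltr01.
near=> r; have [|n [_ n1 hn]] := hr0 r.
  by apply/andP; split; near: r; [exact: nbhs_right_gt|exact: nbhs_right_lt].
have n0 : 0 < n%:R :> R by rewrite ltr0n.
have l0 : ln rho < 0 by rewrite ln_lt0// rho0.
have /andP[q1 q2] := ln_cover_wt_bound H n ch.
have h1 : 0 <= ln (cover_wt n (Ds n)) / (n%:R * ln rho).
  by rewrite mulr_le0// invr_le0 pmulr_rle0// ltW.
have h2 : ln (cover_wt n (Ds n)) / (n%:R * ln rho) <= ln p0 / ln rho.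
  have -> : ln p0 / ln rho = n%:R * ln p0 / (n%:R * ln rho).
    by field; rewrite (lt_eqF l0) (gt_eqF n0).
  by rewrite ler_wnM2r// invr_le0 pmulr_rle0// ltW.
by move: hn; rewrite ler_norml => /andP[h3 h4]; apply/andP; split; lra.
Unshelve. all: by end_near.
Qed.

End Balls.

(** * Approximation by periodic points *)

(* [lam / (k + T)] is the rate of the cycle of length [k + T]; it only has to be
   compared with [q / (k + J)], up to O(1) in the numerator. *)
Lemma cycle_error (R : realFieldType) (q A lam lnp lnC K k T J C : R) :
  0 <= k -> 1 <= T -> T <= C -> 0 <= J -> 0 <= lnC -> 0 <= A -> A <= lam ->
  lam <= A + lnC -> lnp <= 0 -> q <= 0 -> 0 <= K ->
  `|q - (k * lnp + A)| <= K ->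
  `|q - (J + k) * (lnp + lam / (k + T))| <=
    K + lnC + J * - lnp + (K + lnC - lnp) * (C + J).
Proof.
move=> k0 T1 TC J0 lnC0 A0 Al lC lp q0 K0; rewrite ler_norml => /andP[h1 h2].
have L0 : 0 < k + T by lra.
pose c := lam / (k + T); have lamE : lam = c * (k + T) by rewrite divfK// gt_eqF.
have c0 : 0 <= c by rewrite divr_ge0 ?(ltW L0)//; lra.
have c1 : c <= K + lnC - lnp.
  rewrite ler_pdivrMr// mulrDr.
  have e1 : (K + lnC) * 1 <= (K + lnC) * (k + T) by rewrite ler_wpM2l; lra.
  have e2 : T * lnp <= 0 by rewrite mulr_ge0_le0//; lra.
  by lra.
have cT : c * T <= (K + lnC - lnp) * C by rewrite ler_pM//; lra.
have cJ : c * J <= (K + lnC - lnp) * J by rewrite ler_wpM2r.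
have cT0 : 0 <= c * T by rewrite mulr_ge0//; lra.
have cJ0 : 0 <= c * J by rewrite mulr_ge0.
have Jlp : J * lnp <= 0 by rewrite mulr_ge0_le0.
rewrite -/c; rewrite lamE in Al lC.
have K'C : 0 <= (K + lnC - lnp) * C by rewrite mulr_ge0//; lra.
have K'J : 0 <= (K + lnC - lnp) * J by rewrite mulr_ge0//; lra.
rewrite ler_norml; apply/andP; split; lra.
Qed.

Lemma uniform_bound (R : realType) (T : choiceType) (X : set T) (P : T -> R -> Prop) :
  finite_set X -> (forall a C C', C <= C' -> P a C -> P a C') ->
  (forall a, X a -> exists C, P a C) -> exists C, forall a, X a -> P a C.
Proof.
move=> /finite_seqP[s ->] mono; elim: s => [|a s IH] hP; first by exists 0.
have [|C hC] := IH; first by move=> b bs; apply: hP; rewrite /= in_cons bs orbT.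
have [C' hC'] : exists C', P a C' by apply: hP; rewrite /= in_cons eqxx.
exists (Num.max C C') => b /=; rewrite in_cons => /orP[/eqP ->|bs].
  by apply: mono hC'; rewrite le_max lexx orbT.
by apply: mono (hC _ bs); rewrite le_max lexx.
Qed.

(** * Finiteness of loop classes and positive connections *)

Section LoopClass.
Context {R : realType} {m : nat}.
Variables (rho : R) (d p : 'I_m.+1 -> R).
Hypothesis H : unit_ifs rho d p.
Variable X : set (charvec R).
Hypothesis HX : loop_class rho d X.

Local Notation word n := (n.-tuple 'I_m.+1).
Local Notation S := (S_word rho d).
Local Notation net := (net rho d).
Local Notation char_vec := (char_vec rho d).
Local Notation is_child := (is_child rho d).
Local Notation all_ge1 := (all_ge1 rho d p).
Local Notation p0 := (p ord0).

Let rho0 : 0 < rho. Proof. by have /andP[] := ui_rho H. Qed.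
Let rn0 n : 0 < rho ^+ n. Proof. exact: exprn_gt0. Qed.

Definition keys : set (R * seq R) :=
  [set k | exists n E, E \in net n /\ k = (char_vec n E).1].

(** A normalized length is a difference of two offsets from [endpoint_offsets], and a neighbour list
    is a sorted selection of offsets, that is, a mask applied to [srt]. *)
Lemma finite_keys : finite_set keys.
Proof.
have [G [/finite_seqP[s ->] _ _ hG]] := endpoint_offsets H.
pose srt := sort <=%R (undup s).
pose masks := [seq mask b srt | b : (size srt).-tuple bool].
pose dif := [seq x - y | x <- s, y <- s].
apply: (sub_finite_set _ (finite_seq [seq (x, y) | x <- dif, y <- masks])).
move=> _ [n [E [En ->]]] /=; have /netP[E1 E2 ltE _] := En.
have pos (w : word n) e : sub_itv E (S w 0, S w 1) -> e \in endpoints rho d n ->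
    E.1 <= e <= E.2 -> rho ^- n * (e - S w 0) \in s.
  move=> /andP[/= h1 h2] en /andP[h3 h4]; apply: hG => //.
  by rewrite (le_trans h1)// (le_trans h4).
apply: allpairs_f.
  have [w hw] : exists w : word n, S w 0 <= E.1 < S w 1.
    apply: (exists_cover_right H).
    have /andP[-> _] := endpoints01 H E1; have /andP[_ ?] := endpoints01 H E2.
    exact: lt_le_trans ltE _.
  rewrite -cover_net_left// in hw.
  apply/allpairsP; exists (rho ^- n * (E.2 - S w 0), rho ^- n * (E.1 - S w 0)); split.
  - by apply: pos; rewrite ?lexx ?ltW.
  - by apply: pos; rewrite ?lexx ?ltW.
  - by rewrite /= /ell -mulrBr opprB addrA subrK.
have -> : nbhd rho d n E = [seq c <- srt | c \in nbhd rho d n E].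
  apply: (irr_sorted_eq lt_trans (@ltxx _ _)); first exact: sorted_nbhd.
    by apply: (sorted_filter lt_trans); rewrite sort_lt_sorted undup_uniq.
  move=> c; rewrite mem_filter; case: (boolP (c \in nbhd _ _ _ _)) => //= cn.
  rewrite mem_sort mem_undup; move: cn => /(mem_nbhd H)[w cov e]; symmetry.
  have -> : c = rho ^- n * (E.1 - S w 0).
    by rewrite e opprB addrC subrK mulrA mulVf ?mul1r// gt_eqF.
  by apply: pos; rewrite ?lexx ?ltW.
rewrite filter_mask; apply/mapP.
by exists (map_tuple (fun c => c \in nbhd rho d n E) (in_tuple srt)); rewrite ?mem_enum.
Qed.

Lemma loop_class_parent b : X b -> exists2 a, X a & is_child a b.
Proof.
case: HX => _ _ loop Xb; have [s [s0 [ps Xs] ls]] := loop b b Xb Xb.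
move: s0 ps Xs ls; case/lastP: s => // s c _; rewrite rcons_path last_rcons.
move=> /andP[_ hc] Xs <-; exists (last b s) => //.
by apply: Xs; rewrite -cats1 -cat_cons mem_cat mem_last.
Qed.

(** Finitely many keys do not bound the ranks by themselves. But each letter of the class is a child
    of some letter, and all children of letters with a given key occur at the level just below any
    one net interval with that key. *)
Lemma finite_loop_class : finite_set X.
Proof.
apply: (sub_finite_set (B := \bigcup_(k in keys)
    [set b | exists2 a, a.1 = k & is_child a b])).
  move=> b /loop_class_parent[a _ ab]; exists a.1; last by exists a.
  have /asboolP[[[n E] D] [/and3P[En _ _] <- _]] := ab.
  by exists n, E.
apply: bigcup_finite; first exact: finite_keys.
move=> _ [n [E [En ->]]].
apply: (sub_finite_set _ (finite_seq (map (char_vec n.+1) (net n.+1)))).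
move=> b [a ea ab] /=; have [D /and3P[_ Dn _] <-] := exists_child H ab En (esym ea).
exact: map_f.
Qed.

(** Go from a to the head of the positive path, follow it, and go on to b; without zero rows or
    columns the product remains positive. *)
Lemma positive_connection a b : positive_type rho d p X -> X a -> X b ->
  exists t, [/\ t <> [::], admissible_in rho d X a t, last a t = b & all_ge1 a t].
Proof.
move=> [a0 [s0 [[ps0 Xs0] /(strictly_positive_all_ge1 H) pos]]] Xa Xb.
case: HX => _ _ loop.
have Xa0 : X a0 by apply: Xs0; rewrite mem_head.
have Xl : X (last a0 s0) by apply: Xs0; rewrite mem_last.
have [t1 [t10 [pt1 Xt1] lt1]] := loop _ _ Xa Xa0.
have [t3 [t30 [pt3 Xt3] lt3]] := loop _ _ Xl Xb.
exists (t1 ++ (s0 ++ t3)); split.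
- by case: (t1) t10.
- split; first by rewrite !cat_path pt1 lt1 ps0.
  move=> c; rewrite -cat_cons !mem_cat => /or3P[/Xt1//|cs|ct].
    by apply: Xs0; rewrite in_cons cs orbT.
  by apply: Xt3; rewrite in_cons ct orbT.
- by rewrite !last_cat lt1.
- by apply: (all_ge1_catl H) => //; rewrite lt1; apply: (all_ge1_catr H).
Qed.

End LoopClass.

(** * Closing a path into a positive cycle *)

Section PeriodicApproximation.
Context {R : realType} {m : nat}.
Variables (rho : R) (d p : 'I_m.+1 -> R).
Variable mu : probability (measurableTypeR R) R.
Hypothesis Hmu : standard_assumptions rho d p mu.
Variable X : set (charvec R).
Hypothesis HX : loop_class rho d X.
Hypothesis Xpos : positive_type rho d p X.

Local Notation net_chain := (net_chain rho d).
Local Notation is_child := (is_child rho d).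
Local Notation all_ge1 := (all_ge1 rho d p).
Local Notation nrm := (nrm rho d p).
Local Notation cover_wt := (cover_wt rho d p).
Local Notation p0 := (p ord0).

Let H : unit_ifs rho d p. Proof. exact: standard_unit_ifs Hmu. Qed.

Lemma periodic_approx Ds g J : net_chain Ds g -> (0 < J)%N ->
  (forall j, (J <= j)%N -> X (g j)) ->
  exists K, forall n, (J <= n)%N -> exists z tau,
    [/\ positive_periodic rho d p X z, has_dim mu z (tau / ln rho)%:E &
      `|ln (cover_wt n (Ds n)) - n%:R * tau| <= K].
Proof.
move=> ch J0 Xg.
pose conn a t := [/\ t <> [::], admissible_in rho d X a t, last a t = g J & all_ge1 a t].
(* One C bounds the length and the norm of a closing path from every letter back to [g J]:
   finiteness of the class makes the final K independent of n. *)
have [|a C C' CC [t [? h1 h2]]|a Xa|C hC] := @uniform_bound R _ X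
    (fun a C => exists t, [/\ conn a t, (size t)%:R <= C & nrm a t <= C]).
- exact: (finite_loop_class H HX).
- by exists t; split => //; apply: le_trans CC.
- have [t ct] := positive_connection H HX Xpos Xa (Xg J (leqnn J)).
  exists (Num.max (size t)%:R (nrm a t)), t; split => //.
    by rewrite le_max lexx.
  by rewrite le_max lexx orbT.
have [K2 K20 hK2] := ln_cover_wt_nrm H J ch.
pose K3 := K2 + `|ln C| - ln p0.
exists (K2 + `|ln C| + J%:R * - ln p0 + K3 * (`|C| + J%:R)) => n Jn.
set k := (n - J)%N; have nE : (J + k)%N = n by rewrite subnKC.
have gn := Xg n Jn; have [t [[t0 [pt Xt] lt pos] szt nt]] := hC _ gn.
pose s1 := seg g J k; have ls1 : last (g J) s1 = g n by rewrite last_seg nE.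
pose s := s1 ++ t; have s0 : s <> [::] by rewrite /s; case: (s1) => [|//]; exact: t0.
have ps1 : path is_child (g J) s1.
  by apply: path_seg => i; apply: net_chain_child ch.
have ps : path is_child (g J) s by rewrite cat_path ps1 ls1.
have ls : last (g J) s = g J by rewrite last_cat ls1.
pose g' := cycle_from g J s.
have g'le j : (j <= J)%N -> g' j = g j by apply: cycle_from_lt.
have g'c : forall j, is_child (g' j) (g' j.+1).
  by apply: cycle_from_child => // j _; apply: net_chain_child ch.
have g'0 : g' 0%N = char_vec rho d 0 (0, 1).
  rewrite g'le//; have [_ ->] := ch 0%N; congr (char_vec _ _ _ _).
  exact: net0_mem (net_chain_net 0 ch).
have [z rep] := exists_symbolic_rep H g'0 g'c.
have [Ds' ch' zD] := (symbolic_rep_chain rho d z g').1 rep.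
have g'J : g' J = g J by apply: g'le.
have [lam [A0 Al lu]] : exists lam, [/\ 0 <= ln (nrm (g' J) s1),
    ln (nrm (g' J) s1) <= lam, lam <= ln (nrm (g' J) s) &
    let tau := ln p0 + lam / (size s)%:R in
    forall e, 0 < e -> exists K, forall n, (J <= n)%N ->
      `|ln (cover_wt n (Ds' n)) - n%:R * tau| <= e * n%:R + K].
  apply: (cycle_rate H ch'); rewrite ?g'J ?ls1// => i.
  exact: seg_cycle_from.
rewrite g'J in A0 Al lu; set L := size s in lu *.
move=> /= rate; exists z, (ln p0 + lam / L%:R); split.
- exists (g J), s; split => //.
  + split => // b; rewrite -cat_cons mem_cat => /orP[|bt]; last first.
      by apply: Xt; rewrite in_cons bt orbT.
    rewrite in_cons => /orP[/eqP ->|/mapP[i _ ->]]; first exact: Xg.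
    by apply: Xg; apply: leq_addr.
  + by apply/(strictly_positive_all_ge1 H)/(all_ge1_catl H) => //; rewrite ls1.
  (* The prefix in [has_period] has q + 1 letters, hence at least one; this is why J is positive. *)
  + exists g' => //; exists J.-1 => i; rewrite prednK//.
    exact: cycle_fromD.
- exact: (rate_has_dim Hmu ch' zD rate).
have a0 : (0 < size (nb (g J)))%N.
  have := cover_wt_gt0 H (net_chain_net J ch); have [_ e] := ch J.
  rewrite (cover_wt_sum H (esym e)); case: (size _) => //.
  by rewrite big_ord0 ltxx.
have an : (0 < size (nb (g n)))%N.
  have [k' hk' _] := path_entry_row H ps1 a0.
  by rewrite ls1 in hk'; apply: leq_ltn_trans hk'.
have N1 : 0 < nrm (g J) s1 by apply: lt_le_trans (nrm_ge1 H ps1 a0).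
have Nt : 1 <= nrm (g n) t by apply: (nrm_ge1 H).
have lamC : lam <= ln (nrm (g J) s1) + `|ln C|.
  (* Closing the path multiplies the norm by at most C, so lam stays within [|ln C|] of the
     logarithm of the norm of the original segment, which [hK2] compares with ln Q_n. *)
  apply: le_trans lu _; apply: (@le_trans _ _ (ln (nrm (g J) s1) + ln C)); last first.
    by rewrite lerD2l ler_norm.
  have C0 : 0 < C by rewrite (lt_le_trans _ nt)// (lt_le_trans _ Nt).
  have Ns : 0 < nrm (g J) s by apply: lt_le_trans (nrm_ge1 H ps a0).
  rewrite -lnM ?posrE// ler_ln ?posrE ?mulr_gt0//.
  apply: le_trans (nrm_cat_le H _ _ _) _; rewrite ls1.
  by rewrite ler_pM2l.
have := hK2 k; rewrite nE -/s1.
have /andP[_ q0] := ln_cover_wt_bound H n ch.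
have lp := ln_p0_le0 H.
have LE : L%:R = k%:R + (size t)%:R :> R by rewrite /L size_cat size_seg natrD.
have nR : n%:R = J%:R + k%:R :> R by rewrite -natrD nE.
have st1 : 1 <= (size t)%:R :> R by rewrite ler1n lt0n size_eq0; apply/eqP.
have CC : (size t)%:R <= `|C| by apply: le_trans szt (ler_norm _).
have nC := normr_ge0 (ln C).
rewrite LE nR; move: (ln (nrm _ _)) (ln (cover_wt _ _)) A0 Al lamC q0 => A q A0 Al lamC q0 hq.
apply: (cycle_error (A := A) (lnC := `|ln C|)) => //.
Qed.

End PeriodicApproximation.

Theorem theorem5p1 (R : realType) (m : nat) (rho : R) (d p : 'I_m.+1 -> R)
    (mu : probability (measurableTypeR R) R) (X : set (charvec R))
    (Hmu : standard_assumptions rho d p mu)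
    (HX : loop_class rho d X)
    (Xpos : positive_type rho d p X) :
  let periodic_dims :=
    [set y | exists2 x, positive_periodic rho d p X x & has_dim mu x y] in
  [/\ dense_in periodic_dims
        [set y | exists2 x, point_in rho d X x & has_dim mu x y],
      dense_in periodic_dims [set upper_dim mu x | x in point_in rho d X] &
      dense_in periodic_dims [set lower_dim mu x | x in point_in rho d X]].
Proof.
move=> pd.
have per_in x : positive_periodic rho d p X x -> point_in rho d X x.
  case=> a [s [s0 la [_ Xs] _ [g rep [q hq]]]]; exists g => //.
  exists q.+1 => // j /= qj; rewrite -(subnKC qj) hq; apply: Xs.
  have L0 : (0 < size s)%N by case: (s) s0.
  apply: mem_belast; apply: mem_nth; rewrite size_belast; exact: ltn_pmod.
have bnd x : point_in rho d X x ->
    exists l u, ((0 : R)^'+) [set r | l <= dim_ratio mu x r <= u].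
  move=> [g /symbolic_rep_chain[Ds ch xD] _].
  by eexists; eexists; exact: (dim_ratio_bounded Hmu ch xD).
have up x : point_in rho d X x -> exists2 y : R, upper_dim mu x = y%:E &
    forall e, 0 < e -> forall V, ((0 : R)^'+) V ->
      exists2 r, V r & `|dim_ratio mu x r - y| < e.
  by move=> /bnd[l [u F0]]; exact: limf_esup_freq F0.
have lo x : point_in rho d X x -> exists2 y : R, lower_dim mu x = y%:E &
    forall e, 0 < e -> forall V, ((0 : R)^'+) V ->
      exists2 r, V r & `|dim_ratio mu x r - y| < e.
  by move=> /bnd[l [u F0]]; exact: limf_einf_freq F0.
have has_dimE x y : point_in rho d X x -> has_dim mu x y ->
    upper_dim mu x = y /\ lower_dim mu x = y.
  move=> xin hy; have [z ez hz] := up x xin.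
  move: (hy); rewrite /has_dim (cvg_freq_unique _ hy hz) => hz'.
  exact: limf_cvg hz'.
(* Nothing is assumed of y except that the ratio at x approaches it for arbitrarily small r. *)
have dense x y : point_in rho d X x ->
    (forall e, 0 < e -> forall V, ((0 : R)^'+) V ->
      exists2 r, V r & `|dim_ratio mu x r - y| < e) -> closure pd y%:E.
  move=> [g /symbolic_rep_chain[Ds ch xD] [J0 _ XJ]] hy B /nbhs_EFin_dist[e e0 he].
  have [||K hK] := periodic_approx Hmu HX Xpos (J := J0.+1) ch.
  - by [].
  - by move=> j jJ; apply: XJ; apply: ltnW.
  have l0 : ln rho < 0 by rewrite ln_lt0//; case: Hmu.
  have e3 : 0 < e / 3 by rewrite divr_gt0.
  (* For n >= N the bounded error K, divided by n |ln rho|, is at most e / 3. The other two thirds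
     are spent on y against the ratio at r, and on that ratio against ln Q_n / (n ln rho). *)
  pose N := maxn J0.+1 (Num.truncn (`|K| / (e / 3 * - ln rho))).+1.
  have [r0 r00 hr0] := dim_ratio_net Hmu ch xD N e3.
  have [r [rp rr0] hr] := hy _ e3 _
    (filterI (nbhs_right_gt (0 : R)) (nbhs_right_lt r00)).
  have [|n [Nn n1 hn]] := hr0 r; first by rewrite rp.
  have [|z [tau [zper zdim ztau]]] := hK n.
    by apply: leq_trans Nn; rewrite leq_max leqnn.
  exists (tau / ln rho)%:E; split; first by exists z.
  apply: he; have n0 : 0 < n%:R :> R by rewrite ltr0n.
  have nl0 : 0 < n%:R * - ln rho by rewrite mulr_gt0// oppr_gt0.
  set Q := ln _ in hn ztau.
  have hq : `|Q / (n%:R * ln rho) - tau / ln rho| <= e / 3.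
    have -> : Q / (n%:R * ln rho) - tau / ln rho = - ((Q - n%:R * tau) / (n%:R * - ln rho)).
      by field; rewrite ?(lt_eqF l0) ?(gt_eqF n0) ?oppr_eq0 ?(lt_eqF l0).
    rewrite normrN normrM [X in _ * X]ger0_norm ?invr_ge0 ?(ltW nl0)//.
    rewrite ler_pdivrMr// (le_trans ztau)// (le_trans (ler_norm _))//.
    rewrite mulrCA -ler_pdivrMr ?mulr_gt0 ?oppr_gt0//.
    apply: le_trans (ltW (truncnS_gt _)) _; rewrite ler_nat; apply: leq_trans Nn.
    by rewrite leq_max leqnn orbT.
  move: hr hn hq; move: (dim_ratio _ _ _) (Q / _) (tau / _) => u v w h1 h2 h3.
  have -> : w - y = (u - y) - (u - v) - (v - w) by ring.
  have -> : e = e / 3 + e / 3 + e / 3 by field.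
  apply: le_lt_trans (ler_normB _ _) _; apply: ltr_leD => //.
  by apply: le_lt_trans (ler_normB _ _) _; apply: ltr_leD.
split; split.
- by move=> y [x /per_in xin hy]; exists x.
- move=> y [x xin hy]; have [z ez hz] := up x xin.
  by rewrite -(has_dimE x y xin hy).1 ez; apply: dense hz.
- move=> y [x /per_in xin hy]; exists x => //.
  exact: (has_dimE x y xin hy).1.
- by move=> _ [x xin <-]; have [z -> hz] := up x xin; apply: dense hz.
- move=> y [x /per_in xin hy]; exists x => //.
  exact: (has_dimE x y xin hy).2.
- by move=> _ [x xin <-]; have [z -> hz] := lo x xin; apply: dense hz.
Qed.
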